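(* Let $G$ be a graph with vertex set $\{1,\ldots,r\}$. If $G$ is a pseudoforest, then $\overline{\mathrm{astab}}(I(G))=\phi_0(G)$.
   Context: Graphs are finite and simple. A graph is a pseudoforest if each of its connected components is either a tree or a unicyclic graph (a connected graph with exactly one cycle). $K$ is a field and $R=K[x_1,\ldots,x_r]$. The edge ideal of $G$ is $I(G)=(x_ix_j\mid \{i,j\}\in E(G))\subseteq R$. The integral closure $\overline{J}$ of an ideal $J$ of $R$ is the ideal of all $x\in R$ satisfying an equation $x^n+a_1x^{n-1}+\cdots+a_n=0$ with $n\geqslant 1$ and $a_i\in J^i$ for all $i$. For an ideal $I$ of $R$, $$\overline{\mathrm{astab}}(I)=\min\{n_0\geqslant 1\mid \mathrm{Ass}(R/\overline{I^n})=\mathrm{Ass}(R/\overline{I^{n_0}})\text{ for all } n\geqslant n_0\}.$$ A leaf is a vertex of degree one and a leaf edge is an edge incident with a leaf; $\upsilon(G)$ and $\varepsilon_0(G)$ denote the numbers of vertices and of leaf edges of $G$. Definition of $n_0(G)$ and $\phi_0(G)$: let $G_1,\ldots,G_s$ be all the connected nonbipartite components of $G$, let $2k_i-1$ be the minimum length of odd cycles of $G_i$ for $i=1,\ldots,s$, and let $2k-1$ be the minimum length of odd cycles of $G$. Define $$n_0(G)=\begin{cases}1 & \text{if } s=0,\\ \sum_{i=1}^s(\upsilon(G_i)-\varepsilon_0(G_i)-k_i)+j+k & \text{if } s=2j \text{ for } j\geqslant 1,\\ \sum_{i=1}^s(\upsilon(G_i)-\varepsilon_0(G_i)-k_i)+j+1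 & \text{if } s=2j+1 \text{ for } j\geqslant 0,\end{cases}$$ and $\phi_0(G)=\max\{n_0(G')\mid G' \text{ consists of some connected components of } G\}$. *)

(* Defs.v *)
From mathcomp Require Import all_boot all_order all_algebra.
From mathcomp Require Import mpoly.

Set Implicit Arguments.
Unset Strict Implicit.
Unset Printing Implicit Defensive.

Import GRing.Theory.

(* An ambient simple graph is a symmetric irreflexive [e : rel T].  The notions
   below take a vertex set [S] and concern the induced subgraph e[S]. *)
Section Graphs.
Variable T : finType.
Implicit Types (e : rel T) (S C : {set T}) (c : seq T).

Definition induced e S : rel T := [rel x y | [&& x \in S, y \in S & e x y]].

Definition components e S : {set {set T}} :=
  equivalence_partition (connect (induced e S)) S.

Definition connected_graph e S : Prop :=
  S != set0 /\ {in S &, forall x y, connect (induced e S) x y}.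

Definition is_cycle e S c : bool :=
  [&& 2 < size c, ucycleb e c & all (mem S) c].

(* Vertex sequences differing by a rotation or a reversal describe the same
   cycle; a cycle is identified by its edge set. *)
Definition cycle_edges c : {set {set T}} := [set [set x; next c x] | x in c].

Definition is_tree e S : Prop :=
  connected_graph e S /\ forall c, ~~ is_cycle e S c.

Definition is_unicyclic e S : Prop :=
  connected_graph e S /\
  exists2 c, is_cycle e S c &
    forall c', is_cycle e S c' -> cycle_edges c' = cycle_edges c.

Definition pseudoforest e : Prop :=
  forall C, C \in components e setT -> is_tree e C \/ is_unicyclic e C.

Definition bipartite e S : bool :=
  [exists A : {set T}, forall x in S, forall y in S,
     e x y ==> ((x \in A) != (y \in A))].

Definition degree e S (x : T) : nat := #|[set y in S | e x y]|.

Definition edges e S : {set {set T}} :=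
  [set [set x; y] | x in S, y in S & e x y].

Definition leaf_edges e S : {set {set T}} :=
  [set f in edges e S | [exists x in f, degree e S x == 1]].

Definition has_odd_cycle e S (n : nat) : bool :=
  odd n && [exists t : n.-tuple T, is_cycle e S t].

(* Meaningful when e[S] has an odd cycle; the default value #|T|.+1 exceeds the
   length of every cycle. *)
Definition odd_girth e S : nat :=
  \big[minn/#|T|.+1]_(n < #|T|.+1 | has_odd_cycle e S n) n.

(* The number k such that odd_girth e S = 2k - 1. *)
Definition half_odd_girth e S : nat := (odd_girth e S).+1./2.

Definition nonbip_components e S : {set {set T}} :=
  [set C in components e S | ~~ bipartite e C].

(* The natural-number subtractions are exact: in a connected nonbipartite graph
   every leaf edge has exactly one leaf, distinct leaf edges have distinct
   leaves, and no leaf lies on a cycle, so that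
   #|C| - #|leaf_edges e C| >= 2k - 1 >= k for k := half_odd_girth e C. *)
Definition n0 e S : nat :=
  let s := #|nonbip_components e S| in
  let sigma := \sum_(C in nonbip_components e S)
                 (#|C| - #|leaf_edges e C| - half_odd_girth e C) in
  if s == 0 then 1
  else if odd s then sigma + s./2 + 1
  else sigma + s./2 + half_odd_girth e S.

(* P = set0 is allowed; it contributes the value 1, which is needed only when
   there are no vertices. *)
Definition phi0 e : nat :=
  \max_(P in powerset (components e setT)) n0 e (cover P).

End Graphs.

Section Ideals.
Local Open Scope ring_scope.
Variable A : comNzRingType.
Implicit Types (G I J P : A -> Prop).

Definition is_ideal J : Prop :=
  [/\ J 0, forall x y, J x -> J y -> J (x + y) & forall a x, J x -> J (a * x)].

Definition is_prime_ideal P : Prop :=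
  [/\ is_ideal P, ~ P 1 & forall x y, P (x * y) -> P x \/ P y].

Definition ideal_gen G : A -> Prop := fun x =>
  exists (n : nat) (a g : 'I_n -> A),
    (forall i, G (g i)) /\ x = \sum_(i < n) a i * g i.

Definition ideal_mul I J : A -> Prop :=
  ideal_gen (fun z => exists x y, [/\ I x, J y & z = x * y]).

Definition ideal_pow J (n : nat) : A -> Prop :=
  iter n (ideal_mul J) (fun _ => True).

Definition integral_closure J : A -> Prop := fun x =>
  exists (n : nat) (a : nat -> A),
    [/\ (1 <= n)%N,
        forall i, (1 <= i <= n)%N -> ideal_pow J i (a i)
      & x ^+ n + \sum_(1 <= i < n.+1) a i * x ^+ (n - i) = 0].

(* P belongs to Ass(A/J): P is a prime ideal and the annihilator of the class
   of some f in A/J. *)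
Definition Ass J P : Prop :=
  is_prime_ideal P /\ exists f, forall x, P x <-> J (x * f).

Definition Ass_closure_stable_from I (m : nat) : Prop :=
  forall n, (m <= n)%N -> forall P,
    Ass (integral_closure (ideal_pow I n)) P <->
    Ass (integral_closure (ideal_pow I m)) P.

(* The relation "astab-bar(I) = m": m is the least element of the set of
   stability indices >= 1. *)
Definition is_astab_closure I (m : nat) : Prop :=
  [/\ (1 <= m)%N, Ass_closure_stable_from I m
    & forall n, (1 <= n)%N -> Ass_closure_stable_from I n -> (m <= n)%N].

End Ideals.

Definition edge_ideal (K : fieldType) (r : nat) (e : rel 'I_r) :
    {mpoly K[r]} -> Prop :=
  ideal_gen (fun f => exists i j, e i j /\ f = ('X_i * 'X_j)%R).
Arguments edge_ideal K {r} e.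

(* Main.v *)
Require Import Defs.
From mathcomp Require Import all_boot all_order all_algebra.
From mathcomp Require Import mpoly zify ring.
From Stdlib Require Import Classical.

Set Implicit Arguments.
Unset Strict Implicit.
Unset Printing Implicit Defensive.
Import GRing.Theory.

(** Write I for the edge ideal and let w range over the vertex weights with
w x + w y >= 2 on every edge, that is, over twice the fractional vertex covers.
A polynomial lies in the integral closure of I^n if and only if each of its
monomials m satisfies sum_x w x * m x >= 2n for all such w
([integral_closure_powP]).  Necessity: w defines a grading, and lowest-degree
terms cannot cancel in an integral equation.  Sufficiency: König's theorem on
the bipartite double cover shows that the square of such a monomial is divisible
by a product of 2n edges, and adding a square root of an element of J^2
preserves integrality over J ([integral_add_sqrt]).

It follows that the primes associated with the closure of I^n are generated by
the variables outside an independent set X such that the graph W left after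
deleting X and its neighbours is empty or carries an expanding weight b of total
2n - 1 ([Ass_closureP]).  Expanding means b(Y) < b(N(Y)) for every nonempty
independent set Y of W.  Adding 1 to b at the ends of an edge keeps b expanding,
so the condition is monotone in n, and only the least odd total of an expanding
weight on W matters.

A nonbipartite component of a pseudoforest is a functional graph: its edges are
the pairs {v, f v} for a map f without 2-cycles, its nonleaf vertices are the
values of f, and its only cycle is odd, of length 2k - 1
([nonbipartite_functional]).  An expanding weight is the degree vector of a
fractional matching.  Cutting the component along an edge shows that the
matching has weight at least 1 on every nonleaf edge outside the cycle, and on
each cycle edge a weight congruent to half the total of b modulo 1, at least
1/2.  If a is the number of nonleaf vertices, an odd total is therefore at least
2a - (2k - 1) and an even total at least 2a ([component_lower_bound]).  Both bounds are
attained by the matching with weight 1 on nonleaf edges, lowered to 1/2 on the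
cycle for an odd total ([half_integral_expanding]).  For s components whose
totals have an odd sum, all totals can be odd when s is odd, while one of them
must be even when s is even, at an extra cost 2k - 1 that is least for the
shortest odd cycle.  This is the case distinction in n0.

Finally, if W carries an expanding weight, then every component of G meeting W
is nonbipartite and has its cycle inside W, and passing from W to that whole
component does not decrease the number of nonleaf vertices
([half_integral_weight]).  Hence the largest index is reached when W is a union
of components, and this maximum is phi0. *)

(** * Matchings in bipartite graphs *)

(** König's theorem, with the matching extracted from an edge set that is minimal
subject to the covering bound.  In a minimal set no two edges share an end:
otherwise each of them has a cover of fewer than N vertices missing only that
edge, and combining the two covers by union on one side and intersection on the
other contradicts the bound. *)
Lemma koenig (T U : finType) (E : {set T * U}) N :
  (forall (A : {set T}) (B : {set U}),
     (forall p, p \in E -> (p.1 \in A) || (p.2 \in B)) -> N <= #|A| + #|B|) ->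
  exists M : {set T * U}, [/\ M \subset E, N <= #|M|,
    {in M &, injective fst} & {in M &, injective snd}].
Proof.
move En: #|E| => n; elim: n E En => [|n IHn] E En covE.
  have E0 : E = set0 by apply/eqP; rewrite -cards_eq0 En.
  exists set0; split; rewrite ?sub0set //; last 2 first.
  - by move=> x y; rewrite inE.
  - by move=> x y; rewrite inE.
  by have := covE set0 set0; rewrite !cards0; apply=> p; rewrite E0 inE.
pose covers (A : {set T}) (B : {set U}) (F : {set T * U}) :=
  [forall p in F, (p.1 \in A) || (p.2 \in B)].
have coversP (A : {set T}) (B : {set U}) (F : {set T * U}) : reflect (forall p, p \in F -> (p.1
  \in A) || (p.2 \in B)) (covers A B F).
  by apply: (iffP forallP) => h p; [move=> pF; have /implyP := h p; apply | apply/implyP/h].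
case: (boolP [exists p in E, [forall A, [forall B, covers A B (E :\ p) ==> (N <= #|A| + #|B|)]]]).
  case/existsP=> p /andP [pE /forallP hp].
  have [||M [ME NM i1 i2]] := IHn (E :\ p).
  - by move: En; rewrite (cardsD1 p) pE => -[].
  - move=> A B /coversP h; have /forallP /(_ B) := hp A.
    by rewrite h.
  by exists M; split=> //; apply: subset_trans ME _; apply: subD1set.
move=> crit.
have {}crit p : p \in E -> exists (A : {set T}) (B : {set U}), [/\ forall q : T * U, q \in E ->
  q != p -> (q.1 \in A) || (q.2 \in B),
    p.1 \notin A, p.2 \notin B & #|A| + #|B| < N].
  move=> pE; move: crit; rewrite negb_exists => /forallP /(_ p).
  rewrite pE /= negb_forall => /existsP [A]; rewrite negb_forall => /existsP [B].
  rewrite negb_imply -ltnNge => /andP [/coversP h lt]; exists A, B.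
  have h' (q : T * U) : q \in E -> q != p -> (q.1 \in A) || (q.2 \in B).
    by move=> qE qp; apply: h; rewrite !inE qp.
  suff : ~~ ((p.1 \in A) || (p.2 \in B)) by rewrite negb_or => /andP [].
  apply/negP=> hp; suff : N <= #|A| + #|B| by rewrite leqNgt lt.
  by apply: covE => q qE; have [->|] := eqVneq q p => //; apply: h'.
exists E; split=> //.
- have := covE [set p.1 | p in E] set0; rewrite cards0 addn0 => h.
  by apply: leq_trans (leq_imset_card fst E); apply: h => p pE; rewrite imset_f.
- move=> p q pE qE epq; apply/eqP/negPn/negP => npq.
  have [A [B [cA pA pB ltA]]] := crit p pE.
  have [A' [B' [cA' qA' qB' ltA']]] := crit q qE.
  have h1 : N <= #|A :&: A'| + #|B :|: B'|.
    apply: covE => r rE; rewrite !inE.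
    have [rp|rp] := eqVneq r p.
      have := cA' r rE; rewrite rp npq epq (negPf qA') /= => /(_ isT) ->; by rewrite ?andbF ?orbT.
    have [rq|rq] := eqVneq r q.
      have := cA r rE rp; rewrite rq -epq (negPf pA) /= => ->; by rewrite ?orbT.
    by case/orP: (cA r rE rp) => ->; case/orP: (cA' r rE rq) => ->; rewrite ?orbT.
  have h2 : N <= #|p.1 |: (A :|: A')| + #|B :&: B'|.
    apply: covE => r rE; rewrite !inE.
    have [->|rp] := eqVneq r p; first by rewrite eqxx.
    have [->|rq] := eqVneq r q; first by rewrite epq eqxx.
    by case/orP: (cA r rE rp) => ->; case/orP: (cA' r rE rq) => ->; rewrite ?orbT.
  have h3 : #|p.1 |: (A :|: A')| <= 1 + #|A :|: A'| by rewrite cardsU1 leq_add2r leq_b1.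
  have := cardsUI A A'; have := cardsUI B B'; lia.
- move=> p q pE qE epq; apply/eqP/negPn/negP => npq.
  have [A [B [cA pA pB ltA]]] := crit p pE.
  have [A' [B' [cA' qA' qB' ltA']]] := crit q qE.
  have h1 : N <= #|A :|: A'| + #|B :&: B'|.
    apply: covE => r rE; rewrite !inE.
    have [rp|rp] := eqVneq r p.
      have := cA' r rE; rewrite rp npq epq (negPf qB') orbF /= => /(_ isT) ->; by rewrite ?orbT.
    have [rq|rq] := eqVneq r q.
      have := cA r rE rp; rewrite rq -epq (negPf pB) orbF /= => ->; by rewrite ?orbT.
    by case/orP: (cA r rE rp) => ->; case/orP: (cA' r rE rq) => ->; rewrite ?orbT.
  have h2 : N <= #|A :&: A'| + #|p.2 |: (B :|: B')|.
    apply: covE => r rE; rewrite !inE.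
    have [->|rp] := eqVneq r p; first by rewrite eqxx orbT.
    have [->|rq] := eqVneq r q; first by rewrite epq eqxx orbT.
    by case/orP: (cA r rE rp) => ->; case/orP: (cA' r rE rq) => ->; rewrite ?orbT.
  have h3 : #|p.2 |: (B :|: B')| <= 1 + #|B :|: B'| by rewrite cardsU1 leq_add2r leq_b1.
  have := cardsUI A A'; have := cardsUI B B'; lia.
Qed.

(** König's theorem for the bipartite double cover of a graph with capacities: a
vertex x is replaced by a x copies, and a cover of the copies by the sets A and B
gives the weight w counting in how many of A and B all copies of x lie. *)
Lemma b_matching (T : finType) (e : rel T) (a : T -> nat) N :
  ssrbool.symmetric e ->
  (forall w : T -> nat, (forall x y, e x y -> 2 <= w x + w y) ->
     N <= \sum_x w x * a x) ->
  exists mu : T -> T -> nat,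
    [/\ forall x y, 0 < mu x y -> e x y,
        forall x, \sum_y mu x y <= a x,
        forall y, \sum_x mu x y <= a y
      & N <= \sum_x \sum_y mu x y].
Proof.
move=> e_sym hw.
pose S := {x : T & 'I_(a x)}.
pose E := [set p : S * S | e (tag p.1) (tag p.2)].
have cardS x : #|[set s : S | tag s == x]| = a x.
  have inj : injective (Tagged (fun x => 'I_(a x)) : 'I_(a x) -> S).
    by move=> i j /eqP; rewrite -tag_eqE /tag_eq eqxx tagged_asE => /eqP.
  rewrite -[RHS]card_ord -(card_imset _ inj); apply: eq_card => -[y i].
  rewrite !inE /=; apply/eqP/imsetP => [yx | [j _ /(congr1 tag)] //].
  by case: x / yx inj => _; exists i.
have [|M [ME NM i1 i2]] := @koenig S S E N.
  move=> A B cov.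
  pose full (A : {set S}) x := [set s : S | tag s == x] \subset A.
  pose w x : nat := full A x + full B x.
  have fullP (A' : {set S}) x : ~~ full A' x -> exists2 s, tag s = x & s \notin A'.
    by case/subsetPn=> s; rewrite inE => /eqP; exists s.
  have fe x y : e x y -> full A x || full B y.
    move=> exy; apply/negPn/negP; rewrite negb_or => /andP [].
    case/fullP=> s sx sA /fullP [t ty tB].
    have := cov (s, t); rewrite inE /= sx ty exy (negPf sA) (negPf tB).
    by move/(_ isT).
  have le (A' : {set S}) : \sum_x full A' x * a x <= #|A'|.
    rewrite -sum1_card (partition_big tag xpredT) //=.
    apply: leq_sum => x _; case: (boolP (full A' x)) => //= /subsetP h.
    rewrite mul1n -[X in X <= _]cardS -sum1_card; apply: eq_leq; apply: eq_bigl => s.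
    by rewrite inE; apply/idP/andP => [sx | [] //]; split=> //; apply: h; rewrite inE.
  apply: leq_trans (leq_add (le A) (le B)); rewrite -big_split /=.
  under eq_bigr => x _ do rewrite -mulnDl.
  apply: hw => x y exy; rewrite /w; have := fe x y exy.
  by rewrite e_sym in exy; have := fe y x exy; case: (full A x); case: (full B x);
    case: (full A y); case: (full B y).
exists (fun x y => #|[set p in M | (tag p.1 == x) && (tag p.2 == y)]|); split.
- move=> x y /card_gt0P [p]; rewrite !inE => /and3P [pM /eqP <- /eqP <-].
  by have := subsetP ME _ pM; rewrite inE.
- move=> x; rewrite -(cardS x).
  apply: leq_trans (_ : #|[set p in M | tag p.1 == x]| <= _).
    rewrite -[leqRHS]sum1_card (partition_big (fun p => tag p.2) xpredT) //=.
    apply: leq_sum => y _; rewrite -sum1_card; apply: eq_leq; apply: eq_bigl => p.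
    by rewrite !inE -andbA.
  rewrite -(card_in_imset (f := fst)); last first.
    by move=> p q; rewrite !inE => /andP [pM _] /andP [qM _]; apply: i1.
  apply: subset_leq_card; apply/subsetP => s /imsetP [p]; rewrite !inE.
  by case/andP=> _ ? ->.
- move=> y; rewrite -(cardS y).
  apply: leq_trans (_ : #|[set p in M | tag p.2 == y]| <= _).
    rewrite -[leqRHS]sum1_card (partition_big (fun p => tag p.1) xpredT) //=.
    apply: leq_sum => x _; rewrite -sum1_card; apply: eq_leq; apply: eq_bigl => p.
    by rewrite !inE -andbA [X in _ && X]andbC.
  rewrite -(card_in_imset (f := snd)); last first.
    by move=> p q; rewrite !inE => /andP [pM _] /andP [qM _]; apply: i2.
  apply: subset_leq_card; apply/subsetP => s /imsetP [p]; rewrite !inE.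
  by case/andP=> _ ? ->.
- apply: leq_trans NM _.
  rewrite -[leqLHS]sum1_card (partition_big (fun p => tag p.1) xpredT) //=.
  apply: leq_sum => x _; rewrite (partition_big (fun p => tag p.2) xpredT) //=.
  apply: leq_sum => y _; rewrite -sum1_card; apply: eq_leq; apply: eq_bigl => p.
  by rewrite !inE -andbA.
Qed.

(** * Powers of ideals and integral dependence *)

Section IdealPowers.
Local Open Scope ring_scope.
Variable A : comNzRingType.
Implicit Types (G I J P : A -> Prop).

Lemma ideal_sum J (I : Type) (s : seq I) (Q : pred I) (F : I -> A) : is_ideal J ->
  (forall i, Q i -> J (F i)) -> J (\sum_(i <- s | Q i) F i).
Proof. by case=> J0 JD _ h; apply: big_ind. Qed.

Lemma ideal_gen_ideal G : is_ideal (ideal_gen G).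
Proof.
split.
- by exists 0, (fun _ => 0), (fun _ => 0); split=> [[]//|]; rewrite big_ord0.
- move=> _ _ [n [a [g [Gg ->]]]] [m [b [h [Gh ->]]]].
  exists (n + m)%N, (fun i => match split i with inl k => a k | inr k => b k end),
    (fun i => match split i with inl k => g k | inr k => h k end); split.
    by move=> i; case: split.
  rewrite big_split_ord /=; congr (_ + _); apply: eq_bigr => i _.
    by rewrite (unsplitK (inl i)).
  by rewrite (unsplitK (inr i)).
- move=> c _ [n [a [g [Gg ->]]]]; exists n, (fun i => c * a i), g; split=> //.
  by rewrite mulr_sumr; apply: eq_bigr => i _; rewrite mulrA.
Qed.

Lemma ideal_gen_sub G J : is_ideal J -> (forall g, G g -> J g) ->
  forall x, ideal_gen G x -> J x.
Proof.
move=> idJ GJ _ [n [a [g [Gg ->]]]]; apply: ideal_sum => // i _.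
by case: idJ => _ _; apply; apply: GJ.
Qed.

Lemma mem_ideal_gen G g : G g -> ideal_gen G g.
Proof.
by move=> Gg; exists 1%N, (fun _ => 1), (fun _ => g); split=> //; rewrite big_ord1 mul1r.
Qed.

Lemma ideal_pow_ideal J n : is_ideal (ideal_pow J n).
Proof. by case: n => [|n]; [split | apply: ideal_gen_ideal]. Qed.

Lemma ideal_pow1 J x : J x -> ideal_pow J 1 x.
Proof. by move=> Jx; apply: mem_ideal_gen; exists x, 1; rewrite mulr1. Qed.

Lemma ideal_powS J n x y : J x -> ideal_pow J n y -> ideal_pow J n.+1 (x * y).
Proof. by move=> Jx Jy; apply: mem_ideal_gen; exists x, y. Qed.

Lemma ideal_powM J i j x y : ideal_pow J i x -> ideal_pow J j y ->
  ideal_pow J (i + j) (x * y).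
Proof.
elim: i x y => [|i IHi] x y; first by move=> _ Jy; case: (ideal_pow_ideal J j) => _ _; apply.
move=> Jx Jy; move: x Jx.
apply: (@ideal_gen_sub _ (fun x => ideal_pow J (i.+1 + j) (x * y))).
  have [J0 JD JM] := ideal_pow_ideal J (i.+1 + j).
  split; first by rewrite mul0r.
    by move=> u v Ju Jv; rewrite mulrDl; apply: JD.
  by move=> a u Ju; rewrite -mulrA; apply: JM.
move=> _ [u [v [Ju Jv ->]]]; rewrite -mulrA addSn; apply: ideal_powS => //.
exact: IHi.
Qed.

End IdealPowers.

Section IntegralSum.
Local Open Scope ring_scope.
Variables (A : comNzRingType) (J : A -> Prop).
Implicit Types (p q : {poly A}).

(** The homogeneous elements of degree d in the Rees algebra of J, graded so that the
polynomial variable has degree one.  An integral equation over J is a root of a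
monic element of this kind. *)
Definition graded d p :=
  forall k, ((k <= d)%N -> ideal_pow J (d - k) p`_k) /\ ((d < k)%N -> p`_k = 0).

Lemma gradedD d p q : graded d p -> graded d q -> graded d (p + q).
Proof.
move=> hp hq k; rewrite coefD; split=> dk; last first.
  by rewrite (hp k).2 // (hq k).2 // addr0.
by have [_ JD _] := ideal_pow_ideal J (d - k); apply: JD; [apply: (hp k).1 | apply: (hq k).1].
Qed.

Lemma gradedN d p : graded d p -> graded d (- p).
Proof.
move=> hp k; rewrite coefN; split=> dk; last by rewrite (hp k).2 // oppr0.
have [_ _ JM] := ideal_pow_ideal J (d - k).
by rewrite -mulN1r; apply: JM; apply: (hp k).1.
Qed.

Lemma graded0 d : graded d 0.
Proof. by move=> k; rewrite coef0; split=> // _; case: (ideal_pow_ideal J (d - k)). Qed.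

Lemma gradedM d1 d2 p q : graded d1 p -> graded d2 q -> graded (d1 + d2) (p * q).
Proof.
move=> hp hq k; rewrite coefM; split=> dk.
  apply: ideal_sum => [|i _]; first exact: ideal_pow_ideal.
  have [J0 _ _] := ideal_pow_ideal J (d1 + d2 - k).
  have [id1|id1] := leqP i d1; last by rewrite (hp i).2 // mul0r.
  have [kd2|kd2] := leqP (k - i) d2; last by rewrite (hq _).2 // mulr0.
  have -> : (d1 + d2 - k = (d1 - i) + (d2 - (k - i)))%N by have := ltn_ord i; lia.
  by apply: ideal_powM; [apply: (hp _).1 | apply: (hq _).1].
rewrite big1 // => i _.
have [id1|id1] := leqP i d1; last by rewrite (hp i).2 // mul0r.
by rewrite (hq (k - i)%N).2 ?mulr0 //; have := ltn_ord i; lia.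
Qed.

Lemma graded_top d1 d2 p q : graded d1 p -> graded d2 q ->
  (p * q)`_(d1 + d2) = p`_d1 * q`_d2.
Proof.
move=> hp hq; rewrite coefM.
have lt : (d1 < (d1 + d2).+1)%N by lia.
rewrite (bigD1 (Ordinal lt)) //= addKn big1 ?addr0 // => i ne.
have ne' : i != d1 :> nat by [].
have [id1|id1] := leqP i d1; last by rewrite (hp i).2 // mul0r.
by rewrite (hq (d1 + d2 - i)%N).2 ?mulr0 //; have := ltn_ord i; lia.
Qed.

Lemma gradedC d c : ideal_pow J d c -> graded d c%:P.
Proof.
move=> Jc [|k]; rewrite coefC /=; first by rewrite subn0.
by split=> // _; case: (ideal_pow_ideal J (d - k.+1)).
Qed.

Lemma gradedX : graded 1 'X.
Proof.
move=> [|[|k]]; rewrite coefX /=; split=> //.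
by move=> _; case: (ideal_pow_ideal J 1).
Qed.

(** The factor 'X ^+ 2 lowers the degree of p by two without naming d - 2, which
would be wrong for d < 2. *)
Lemma graded_square d s p : ideal_pow J 2 s -> graded d ('X * ('X * p)) ->
  graded d (s%:P * p).
Proof.
move=> Js hp k; have := hp k.+2; rewrite coefCM !coefXM /= => -[h1 h2].
have [lt|ge] := leqP k.+2 d; last first.
  rewrite h2 // mulr0; split=> // _.
  by case: (ideal_pow_ideal J (d - k)).
split=> [_|]; last by lia.
have -> : (d - k = 2 + (d - k.+2))%N by lia.
by apply: ideal_powM => //; apply: h1.
Qed.

Lemma integral_closureE x :
  integral_closure J x <->
  exists d p, [/\ (1 <= d)%N, graded d p, p`_d = 1 & p.[x] = 0].
Proof.
have sumE n (c : nat -> A) : \sum_(k < n.+1) c k * x ^+ k =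
    c n * x ^+ n + \sum_(1 <= i < n.+1) c (n - i)%N * x ^+ (n - i).
  rewrite big_ord_recr /= addrC; congr (_ + _).
  rewrite -(big_mkord xpredT (fun k => c k * x ^+ k)) big_add1 big_nat_rev /=.
  by apply: eq_bigr => i _; rewrite add0n.
split.
- case=> n [a [n1 Ja eq]].
  pose c k := if k == n then 1 else a (n - k)%N.
  exists n, (\poly_(k < n.+1) c k); split=> //.
  + move=> k; rewrite coef_poly ltnS /c; split; last by rewrite ltnNge => /negPf ->.
    move=> kn; rewrite kn; have [->|nk] := eqVneq k n; first by rewrite subnn.
    by apply: Ja; lia.
  + by rewrite coef_poly ltnSn /c eqxx.
  rewrite horner_poly sumE /c eqxx mul1r -[RHS]eq; congr (_ + _).
  apply: eq_big_nat => i /andP [i1 lin].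
  have ne : (n - i == n)%N = false by apply/negbTE/negP => /eqP; lia.
  by rewrite ne; have -> : (n - (n - i) = i)%N by lia.
- case=> d [p [d1 hp pd px]]; exists d, (fun i => p`_(d - i)); split=> //.
    move=> i /andP [_ id]; have [h _] := hp (d - i)%N; move: h.
    by rewrite subKn //; apply; apply: leq_subr.
  rewrite -[X in X + _]mul1r -pd -(sumE d (fun k => p`_k)) -[RHS]px.
  rewrite [RHS](horner_coef_wide (n := d.+1)) //.
  by apply/leq_sizeP => k dk; apply: (hp k).2.
Qed.

(** Since only the square of y has a known position in the powers of J, expressions
in y are kept in the form p + y q with p and q free of y. *)
Lemma shifted_power y j : ideal_pow J 2 (y * y) -> exists p q : {poly A},
  [/\ ('X - y%:P) ^+ j = p + y%:P * q, graded j p, p`_j = 1 & graded j ('X * q)].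
Proof.
move=> Jyy; elim: j => [|j [p [q [eq hp pj hq]]]].
  exists 1, 0; rewrite expr0 !mulr0 addr0; split=> //; last exact: graded0.
    exact: gradedC.
  by rewrite coefC.
have hX r : graded j r -> graded j.+1 ('X * r) by move=> hr; apply: (gradedM gradedX).
exists ('X * p - (y * y)%:P * q), ('X * q - p); split.
- by rewrite exprS eq polyCM; ring.
- apply: gradedD; first exact: hX.
  by apply/gradedN/graded_square => //; apply: hX.
- have := hq j.+2; rewrite coefXM /= => -[_ q0].
  by rewrite coefB coefXM coefCM /= q0 // mulr0 subr0.
- by rewrite mulrBr; apply: gradedD; [apply: hX | apply: gradedN; apply: hX].
Qed.

(** If x is a root of the polynomial P, then writing P(T - y) = u + y v the element
x + y is a root of u^2 - y^2 v^2, the norm of P(T - y).  This replaces the usual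
argument with finitely generated modules, and works in every characteristic. *)
Lemma integral_add_sqrt x y : integral_closure J x -> ideal_pow J 2 (y * y) ->
  integral_closure J (x + y).
Proof.
move=> /integral_closureE [d [p [d1 hp pd px]]] Jyy; apply/integral_closureE.
have [u [v [puv hu ud hv]]] : exists u v : {poly A},
    [/\ p \Po ('X - y%:P) = u + y%:P * v, graded d u, u`_d = 1 & graded d ('X * v)].
  rewrite comp_polyE; have sp : (size p <= d.+1)%N by apply/leq_sizeP => k dk; apply: (hp k).2.
  have -> : \sum_(i < size p) p`_i *: ('X - y%:P) ^+ i = \sum_(i < d.+1) p`_i *: ('X - y%:P) ^+ i.
    rewrite (big_ord_widen _ (fun i => p`_i *: ('X - y%:P) ^+ i) sp) [RHS](bigID (fun i :
      'I_d.+1 => (i < size p)%N)) /=.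
    by rewrite [X in _ = _ + X]big1 ?addr0 // => i;
      rewrite -leqNgt => /leq_sizeP /(_ i (leqnn i)) ->; rewrite scale0r.
  have {sp} aux n : (n <= d)%N -> exists u v : {poly A},
    [/\ \sum_(i < n.+1) p`_i *: ('X - y%:P) ^+ i = u + y%:P * v, graded d u,
        u`_d = p`_d *+ (n == d) & graded d ('X * v)].
    have term i : (i <= d)%N -> exists u v : {poly A}, [/\ p`_i *: ('X - y%:P) ^+ i =
      u + y%:P * v,
        graded d u, u`_d = p`_d *+ (i == d) & graded d ('X * v)].
      move=> id; have [r [s [rs hr ri hs]]] := shifted_power i Jyy.
      have hc : graded (d - i) (p`_i)%:P by apply: gradedC; apply: (hp i).1.
      exists ((p`_i)%:P * r), ((p`_i)%:P * s); split.
      - by rewrite rs -mul_polyC; ring.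
      - by rewrite -[X in graded X](subnK id); apply: gradedM.
      - have [E|ne] := eqVneq i d; first by rewrite coefCM -[in r`_d]E ri mulr1 E.
        by rewrite coefCM (hr d).2 ?mulr0 //; lia.
      - by rewrite mulrCA -[X in graded X](subnK id); apply: gradedM.
    elim: n => [|n IHn] nd; first by rewrite big_ord1; apply: term.
    have [u [v [e1 hu ud hv]]] := IHn (ltnW nd).
    have [u' [v' [e2 hu' ud' hv']]] := term _ nd.
    exists (u + u'), (v + v'); split.
    - by rewrite big_ord_recr /= e1 e2; ring.
    - exact: gradedD.
    - by rewrite coefD ud ud' (ltn_eqF nd) mulr0n add0r.
    - by rewrite mulrDr; apply: gradedD.
  have [u [v [e1 hu ud hv]]] := aux d (leqnn d).
  by exists u, v; split=> //; rewrite ud eqxx pd.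
have hvv : graded (d + d) ('X * ('X * (v * v))).
  have -> : 'X * ('X * (v * v)) = ('X * v) * ('X * v) by ring.
  exact: gradedM.
exists (d + d)%N, (u * u - (y * y)%:P * (v * v)); split.
- by lia.
- by apply: gradedD; [apply: gradedM | apply/gradedN/graded_square].
- have := hvv (d + d).+2; rewrite !coefXM /= => -[_ v0].
  by rewrite coefB graded_top // ud mulr1 coefCM v0 ?mulr0 ?subr0 //; lia.
- have : (u + y%:P * v).[x + y] = 0.
    by rewrite -puv horner_comp !hornerE addrK.
  rewrite !hornerE => h.
  have -> : u.[x + y] = - (y * v.[x + y]) by apply/eqP; rewrite -addr_eq0 h.
  by rewrite /=; ring.
Qed.

End IntegralSum.

(** * The integral closure of powers of an edge ideal *)

(** Twice a fractional vertex cover, to stay within the integers. *)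
Definition frac_cover (T : finType) (e : rel T) (w : T -> nat) : Prop :=
  forall x y, e x y -> 2 <= w x + w y.

Section LowOrder.
Local Open Scope ring_scope.
Variable A : idomainType.
Implicit Types (p q : {poly A}).

(** The order of p at zero is at least c. *)
Definition vanish c p := forall j, (j < c)%N -> p`_j = 0.

Lemma vanishM a b p q : vanish a p -> vanish b q -> vanish (a + b) (p * q).
Proof.
move=> hp hq j jab; rewrite coefM big1 // => i _.
have [ia|ai] := ltnP i a; first by rewrite hp // mul0r.
by rewrite (hq (j - i)%N) ?mulr0 //; have := ltn_ord i; lia.
Qed.

Lemma vanishD c p q : vanish c p -> vanish c q -> vanish c (p + q).
Proof. by move=> hp hq j jc; rewrite coefD hp // hq // addr0. Qed.

Lemma vanish_sum c (I : Type) (s : seq I) (P : pred I) (F : I -> {poly A}) :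
  (forall i, P i -> vanish c (F i)) -> vanish c (\sum_(i <- s | P i) F i).
Proof. by move=> h j jc; rewrite coef_sum big1 // => i Pi; apply: h. Qed.

Lemma vanish_cancel c p q : vanish c (p * q) -> p`_0 != 0 -> vanish c q.
Proof.
move=> hpq p0 j; elim/ltn_ind: j => j IH jc.
have := hpq j jc; rewrite coefM big_ord_recl subn0 big1 ?addr0 => [/eqP|i _].
  by rewrite mulf_eq0 (negPf p0) => /eqP.
by have ij := ltn_ord i; rewrite IH ?mulr0 //= /bump; lia.
Qed.

Lemma vanish_exp v q n : vanish v q -> vanish (n * v) (q ^+ n) /\ (q ^+ n)`_(n * v) = q`_v ^+ n.
Proof.
move=> hq; elim: n => [|n [IHv IHc]]; first by rewrite !expr0 coefC; split.
rewrite !exprS mulSn; split; first exact: vanishM.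
have lt : (v < (v + n * v).+1)%N by lia.
rewrite coefM (bigD1 (Ordinal lt)) //= addKn IHc big1 ?addr0 // => i ne.
have ne' : i != v :> nat by [].
have [iv|vi] := ltnP i v; first by rewrite hq // mul0r.
by rewrite IHv ?mulr0 //; have := ltn_ord i; lia.
Qed.

(** If q had order v < d, then q ^+ N would be the only term of the equation with a
nonzero coefficient in degree N * v. *)
Lemma vanish_root N (q : {poly A}) (c : nat -> {poly A}) d : (0 < N)%N ->
  (forall i, (1 <= i <= N)%N -> vanish (d * i) (c i)) ->
  q ^+ N + \sum_(1 <= i < N.+1) c i * q ^+ (N - i) = 0 -> vanish d q.
Proof.
move=> N0 hc eq j; elim/ltn_ind: j => v IH vd.
have hq : vanish v q by move=> k kv; apply: IH => //; apply: ltn_trans vd.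
have [_ top] := vanish_exp N hq.
have := congr1 (fun p : {poly A} => p`_(N * v)) eq.
rewrite coefD top coef0 [X in _ + X](_ : _ = 0) ?addr0.
  by move/eqP; rewrite expf_eq0 N0 => /eqP.
rewrite big_nat; apply: (@vanish_sum (N * v).+1) => // i /andP [i1 iN].
have [hv _] := vanish_exp (N - i) hq.
have := vanishM (hc i _) hv => /(_ _) h k kN; apply: h; first by rewrite i1 -ltnS.
apply: leq_trans kN _; have : (i * v.+1 <= i * d)%N by rewrite leq_mul2l vd orbT.
by rewrite mulnBl; have : (i * v <= N * v)%N; [rewrite leq_mul2r -ltnS iN orbT | nia].
Qed.

End LowOrder.

Section WeightGrading.
Local Open Scope ring_scope.
Variables (K : fieldType) (r : nat).
Implicit Types (p q f g : {mpoly K[r]}) (m : 'X_{1..r}) (w : 'I_r -> nat).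

Definition wt w m : nat := (\sum_i w i * m i)%N.

Lemma wtD w m1 m2 : wt w (m1 + m2)%MM = (wt w m1 + wt w m2)%N.
Proof. by rewrite -big_split; apply: eq_bigr => i _; rewrite mnmDE mulnDr. Qed.

Lemma wtU w i : wt w U_(i)%MM = w i.
Proof.
rewrite /wt (bigD1 i) //= mnm1E eqxx muln1 big1 ?addn0 // => j ji.
by rewrite mnm1E eq_sym (negPf ji) muln0.
Qed.

(** Substituting 'X_i * t ^ (w i) for 'X_i turns the weight w into the degree in t.
The variables are kept besides t, so that monomials of equal weight do not
cancel. *)
Lemma weight_grading w : {phi : {rmorphism {mpoly K[r]} -> {poly {mpoly K[r]}}} |
  forall p j m, ((phi p)`_j)@_m = p@_m *+ (wt w m == j)}.
Proof.
pose c : {rmorphism K -> {poly {mpoly K[r]}}} := polyC \o @mpolyC r K.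
pose phi : {rmorphism {mpoly K[r]} -> {poly {mpoly K[r]}}} :=
  mmap c (fun i => ('X_i)%:P * 'X^(w i)).
have phiX m : phi 'X_[m] = ('X_[m])%:P * 'X^(wt w m).
  rewrite /phi /= mmapX /mmap1 mpolyXE_id.
  rewrite (eq_bigr (fun i => ('X_i ^+ m i)%:P * 'X^(w i * m i))) => [|i _].
    by rewrite big_split /= -rmorph_prod -expr_sum.
  by rewrite exprMn -exprM polyC_exp.
exists phi => p j m.
rewrite {1}[p]mpolyE rmorph_sum coef_sum /= raddf_sum /=.
rewrite [in RHS](mpolyE p) raddf_sum /= -sumrMnl; apply: eq_bigr => m' _.
rewrite mcoeffZ mcoeffX -mul_mpolyC rmorphM phiX.
rewrite /phi /= mmapC /= mulrA -polyCM coefCM coefXn.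
rewrite mulr_natr mcoeffMn mcoeffCM mcoeffX.
by case: eqVneq => [->|_]; rewrite ?(eq_sym j) // !mulr0 !mul0rn.
Qed.

Definition graded_subst w := sval (weight_grading w).

Lemma coef_graded_subst w p j m :
  ((graded_subst w p)`_j)@_m = p@_m *+ (wt w m == j).
Proof. exact: (svalP (weight_grading w)). Qed.

Lemma vanish_graded_subst w c p :
  vanish c (graded_subst w p) <-> (forall m, m \in msupp p -> (c <= wt w m)%N).
Proof.
split=> [h m mp | h j jc].
  rewrite leqNgt; apply/negP=> lt; have := congr1 (mcoeff m) (h _ lt).
  by rewrite coef_graded_subst eqxx mcoeff0 => /eqP; rewrite mcoeff_eq0 mp.
apply/mpolyP=> m; rewrite coef_graded_subst mcoeff0.
case: eqP => [E|_]; last by rewrite mulr0n.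
rewrite mulr1n; apply: memN_msupp_eq0; apply/negP=> /h; rewrite E; lia.
Qed.

Lemma vanish_ideal w c : is_ideal (fun x : {mpoly K[r]} => vanish c (graded_subst w x)).
Proof.
split; first by rewrite rmorph0 => j _; rewrite coef0.
  by move=> u v hu hv; rewrite rmorphD; apply: vanishD.
by move=> a x hx; rewrite rmorphM -[c]add0n; apply: vanishM.
Qed.

Lemma vanish_ideal_pow w (J : {mpoly K[r]} -> Prop) c i :
  (forall x, J x -> vanish c (graded_subst w x)) ->
  forall x, ideal_pow J i x -> vanish (c * i) (graded_subst w x).
Proof.
move=> hJ; elim: i => [|i IHi] x; first by rewrite muln0 => _ j.
apply: (ideal_gen_sub (vanish_ideal w _)).
move=> _ [u [v [Ju Jv ->]]]; rewrite rmorphM mulnS; apply: vanishM.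
  exact: hJ.
exact: IHi.
Qed.

End WeightGrading.
Arguments graded_subst {K r} w.

Section ClosureOfPowers.
Local Open Scope ring_scope.
Variables (K : fieldType) (r : nat) (e : rel 'I_r).
Hypothesis e_sym : ssrbool.symmetric e.
Implicit Types (f : {mpoly K[r]}) (m : 'X_{1..r}) (w : 'I_r -> nat).
Notation I := (edge_ideal K e).

(** By linear programming duality, m lies in n times the Newton polyhedron of I. *)
Definition newton n m := forall w, frac_cover e w -> (n.*2 <= wt w m)%N.

Lemma vanish_edge_ideal w : frac_cover e w ->
  forall x, I x -> vanish 2 (graded_subst w x).
Proof.
move=> cw; apply: (ideal_gen_sub (vanish_ideal K w 2)).
move=> _ [i [j [eij ->]]]; apply/vanish_graded_subst => m.
rewrite -mpolyXD msuppX inE => /eqP ->; rewrite wtD !wtU; exact: cw.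
Qed.

(** The grading by w gives order at least 2 n i to the elements of I ^ (n i), so
[vanish_root] applies to the image of an integral equation. *)
Lemma closure_sub_newton n f : integral_closure (ideal_pow I n) f ->
  forall m, m \in msupp f -> newton n m.
Proof.
move=> [N [a [N1 ha eq]]] m mf w cw.
move: m mf; apply/vanish_graded_subst.
apply: (@vanish_root _ N _ (fun i => graded_subst w (a i))) => //.
  move=> i iN; apply: vanish_ideal_pow (ha i iN) => x.
  by rewrite -mul2n; apply: vanish_ideal_pow; apply: vanish_edge_ideal.
have := congr1 (graded_subst w) eq; rewrite rmorphD rmorphXn rmorph0 rmorph_sum => h;
  rewrite -[RHS]h.
by congr (_ + _); apply: eq_bigr => i _; rewrite rmorphM rmorphXn.
Qed.

Definition edge_mnm (s : seq ('I_r * 'I_r)) : 'X_{1..r} :=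
  (\sum_(p <- s) (U_(p.1) + U_(p.2)))%MM.

Lemma edge_mnm_pow n s : (forall p : 'I_r * 'I_r, p \in s -> e p.1 p.2) -> (n <= size s)%N ->
  ideal_pow I n 'X_[edge_mnm s].
Proof.
elim: n s => [|n IHn] [|p s] //= es sz.
rewrite /edge_mnm big_cons mpolyXD; apply: ideal_powS.
  apply: mem_ideal_gen; exists p.1, p.2; rewrite mpolyXD; split=> //.
  by apply: es; rewrite mem_head.
by apply: IHn => // q qs; apply: es; rewrite inE qs orbT.
Qed.

(** The integer optimum on the bipartite double cover equals the bound 2n, and each
vertex has two copies there: this is the half-integrality of fractional
matchings. *)
Lemma newton_sqr n m : newton n m -> ideal_pow (ideal_pow I n) 2 'X_[m + m].
Proof.
move=> hm.
have [|mu [mu_e mu1 mu2 muN]] := @b_matching _ e (fun i => m i) n.*2 e_sym; first exact: hm.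
pose s : seq ('I_r * 'I_r) := flatten [seq nseq (mu p.1 p.2) p | p <- enum {: 'I_r * 'I_r}].
have sumS (F : 'I_r * 'I_r -> nat) : (\sum_(p <- s) F p = \sum_i \sum_j mu i j * F (i, j))%N.
  rewrite pair_big /= big_flatten big_map big_enum /=; apply: eq_bigr => -[i j] _ /=.
  by rewrite big_nseq iter_addn_0 mulnC.
have es (p : 'I_r * 'I_r) : p \in s -> e p.1 p.2.
  by case/flattenP=> _ /mapP [q _ ->]; rewrite mem_nseq => /andP [/mu_e ? /eqP ->].
have szs : (n.*2 <= size s)%N.
  rewrite -sum1_size sumS; apply: leq_trans muN _.
  by apply: leq_sum => i _; apply: leq_sum => j _; rewrite muln1.
have ns : (n <= size s)%N by apply: leq_trans szs; rewrite -addnn leq_addr.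
have le i : (edge_mnm s i <= (m + m)%MM i)%N.
  rewrite /edge_mnm mnm_sumE sumS mnmDE.
  apply: leq_trans (leq_add (mu1 i) (mu2 i)).
  have -> : (\sum_i0 \sum_j mu i0 j * (U_(i0) + U_(j))%MM i =
     \sum_i0 \sum_j mu i0 j * (i0 == i) + \sum_i0 \sum_j mu i0 j * (j == i))%N.
    rewrite -big_split; apply: eq_bigr => x _; rewrite -big_split; apply: eq_bigr => y _ /=.
    by rewrite mnmDE !mnm1E mulnDr.
  rewrite leq_add //.
    rewrite (bigD1 i) //= [X in (_ + X)%N]big1 ?addn0 => [|x /negPf xi].
      by apply: leq_sum => y _; rewrite eqxx muln1.
    by rewrite big1 // => y _; rewrite xi muln0.
  apply: leq_sum => x _; rewrite (bigD1 i) //= eqxx muln1 [X in (_ + X)%N]big1 ?addn0 // => y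
    /negPf yi.
  by rewrite yi muln0.
have -> : (m + m = (m + m - edge_mnm s) + (edge_mnm (take n s) + edge_mnm (drop n s)))%MM.
  rewrite /edge_mnm -big_cat /= cat_take_drop; apply/mnmP=> i.
  by have := le i; rewrite !(mnmDE, mnmBE) /edge_mnm; lia.
rewrite mpolyXD; have [_ _ JM] := ideal_pow_ideal (ideal_pow I n) 2; apply: JM.
rewrite mpolyXD; apply: ideal_powS; last apply: ideal_pow1.
  by apply: edge_mnm_pow => [p /mem_take /es //|]; rewrite size_takel.
by apply: edge_mnm_pow => [p /mem_drop /es //|]; rewrite size_drop leq_subRL // addnn.
Qed.

Lemma integral_closure_powP n f : integral_closure (ideal_pow I n) f <->
  forall m, m \in msupp f -> newton n m.
Proof.
split; first exact: closure_sub_newton.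
move=> h; rewrite [f]mpolyE big_seq.
apply: (big_rec (fun x => integral_closure (ideal_pow I n) x)).
  exists 1%N, (fun _ => 0); split=> //; last by rewrite big_nat1 expr1 mul0r addr0.
  by move=> i _; case: (ideal_pow_ideal (ideal_pow I n) i).
move=> m x mf hx; rewrite addrC; apply: integral_add_sqrt => //.
have [_ _ JM] := ideal_pow_ideal (ideal_pow I n) 2.
have -> : f@_m *: 'X_[m] * (f@_m *: 'X_[m]) = (f@_m * f@_m)%:MP * 'X_[m + m].
  by rewrite mpolyXD -!mul_mpolyC rmorphM /=; ring.
by apply: JM; apply/newton_sqr/h.
Qed.

End ClosureOfPowers.

(** * Expanding vertex weights *)

Section Expanding.
Variables (T : finType) (e : rel T).
Hypotheses (e_sym : ssrbool.symmetric e) (e_irr : irreflexive e).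
Implicit Types (X Y W C : {set T}) (b m w : T -> nat).

Definition nbrs W X : {set T} := [set v in W | [exists x in X, e x v]].
Definition stable X : Prop := {in X &, forall x y, ~~ e x y}.
Definition expanding b W : Prop := forall Y, Y \subset W -> Y != set0 -> stable Y ->
  \sum_(y in Y) b y < \sum_(v in nbrs W Y) b v.
(** An empty W is a case of its own: the prime is then generated by the neighbours of
X and is associated for every n >= 1, although no weight on W has an odd total. *)
Definition critical_size n W : Prop :=
  W = set0 \/ exists2 b, expanding b W & (\sum_(v in W) b v).+1 = n.*2.
Definition remainder X : {set T} := ~: (X :|: nbrs setT X).

Lemma in_remainder X x : (x \in remainder X) = (x \notin X) && (x \notin nbrs setT X).
Proof. by rewrite in_setC in_setU negb_or. Qed.

Lemma nbrsP W X v : reflect (v \in W /\ exists2 x, x \in X & e x v) (v \in nbrs W X).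
Proof.
rewrite inE; apply: (iffP andP) => [[vW /existsP [x /andP [xX exv]]]|[vW [x xX exv]]].
  by split=> //; exists x.
by split=> //; apply/existsP; exists x; rewrite xX.
Qed.

(** The zeros of w form an independent set Y, and w is at least 2 on the neighbours
of Y.  The strict gain from Y compensates what is lost on Y. *)
Lemma expanding_cover b W w : expanding b W -> frac_cover e w ->
  \sum_(v in W) b v + [exists y in W, w y == 0] <= \sum_(v in W) w v * b v.
Proof.
move=> hb cw; pose Y := [set y in W | w y == 0].
have stY : stable Y.
  move=> x y; rewrite !inE => /andP [_ /eqP wx] /andP [_ /eqP wy]; apply/negP=> /cw.
  by rewrite wx wy.
have YW : Y \subset W by apply/subsetP => y; rewrite inE => /andP [].
have NW : nbrs W Y \subset W by apply/subsetP => y /nbrsP [].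
have le : \sum_(v in W) b v + \sum_(v in nbrs W Y) b v <=
          \sum_(v in W) w v * b v + \sum_(v in Y) b v.
  rewrite (big_setID (nbrs W Y) (A := W)) /= (setIidPr NW).
  rewrite [X in _ <= _ + X]big_mkcond /=.
  have -> : \sum_i (if i \in Y then b i else 0) = \sum_(v in W) (v \in Y) * b v.
    rewrite [RHS]big_mkcond; apply: eq_bigr => v _.
    case: (boolP (v \in Y)) => [/(subsetP YW) -> |_]; first by rewrite mul1n.
    by rewrite mul0n if_same.
  rewrite -big_split /= [X in _ <= X](big_setID (nbrs W Y)) /= (setIidPr NW) addnAC.
  apply: leq_add; rewrite -?big_split /=; apply: leq_sum => v; rewrite ?mul1n.
    case/nbrsP=> vW [y]; rewrite inE => /andP [yW /eqP wy] eyv.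
    have := cw _ _ eyv; rewrite wy add0n => w2; rewrite addnn -mul2n -mulnDl leq_mul2r; lia.
  rewrite !inE => /andP [_ vW]; rewrite vW /= -mulnDl.
  by case: (w v) => [|k] /=; rewrite ?mul1n ?mulSn ?addn0 ?leq_addr.
case: (boolP [exists y in W, w y == 0]) => [/existsP [y /andP [yW wy]]|ne].
  have Y0 : Y != set0 by apply/set0Pn; exists y; rewrite inE yW.
  by have := hb Y YW Y0 stY; lia.
have Y0 : Y = set0.
  apply/setP=> y; rewrite !inE; apply/negbTE/negP => /andP [yW wy].
  by case/negP: ne; apply/existsP; exists y; rewrite yW.
by move: le; rewrite Y0 big_set0; lia.
Qed.

(** An independent set contains at most one end of the edge, and then the other end
is one of its neighbours. *)
Lemma expanding_add_edge b W x y : x \in W -> y \in W -> e x y -> expanding b W ->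
  expanding (fun v => b v + (v == x) + (v == y)) W.
Proof.
move=> xW yW exy hb Y YW Y0 stY; rewrite !big_split /=.
have cnt (Z : {set T}) z : \sum_(v in Z) (v == z) = (z \in Z) :> nat.
  have [zZ|zZ] := boolP (z \in Z).
    by rewrite (bigD1 z) //= eqxx big1 // => v /andP [_ /negPf ->].
  by rewrite big1 // => v vZ; case: eqP => // vz; rewrite -vz vZ in zZ.
rewrite !cnt.
have xN : y \in Y -> x \in nbrs W Y by move=> yY; apply/nbrsP; split=> //; exists y;
  rewrite // e_sym.
have yN : x \in Y -> y \in nbrs W Y by move=> xY; apply/nbrsP; split=> //; exists x.
have := hb Y YW Y0 stY.
by case: (x \in Y) yN => [->//|_]; case: (y \in Y) xN => [->//|_]; lia.
Qed.

Lemma critical_sizeS n W : critical_size n W -> critical_size n.+1 W.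
Proof.
case=> [->|[b hb bn]]; first by left.
have [->|[x xW]] := set_0Vmem W; first by left.
have [y /nbrsP [yW [z]]] : exists y, y \in nbrs W [set x].
  apply/set0Pn/negP => /eqP N0; have := hb [set x]; rewrite N0 big_set0 ltn0.
  rewrite sub1set => h; suff : false by []; apply: h => //; first by apply/set0Pn; exists x;
    rewrite inE.
  by move=> u v; rewrite !inE => /eqP -> /eqP ->; rewrite e_irr.
rewrite inE => /eqP -> exy.
right; exists (fun v => b v + (v == x) + (v == y)); first exact: expanding_add_edge.
have one z' : z' \in W -> \sum_(v in W) (v == z') = 1.
  by move=> zW; rewrite (bigD1 z') //= eqxx big1 // => v /andP [_ /negPf ->].
rewrite !big_split /= !one //; lia.
Qed.

Lemma critical_size_le n n' W : n <= n' -> critical_size n W -> critical_size n' W.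
Proof. by move=> /subnK <-; elim: (n' - n) => // k IH /IH; apply: critical_sizeS. Qed.

(** The monomial with exponents m has colon ideal generated by the variables in C: some
cover separates m from the closure of I^n, multiplying m by a variable in C enters
the closure, and the exponents outside C are so large that these variables act as
units. *)
Definition critical n C m : Prop :=
  [/\ exists2 w, frac_cover e w & \sum_x w x * m x < n.*2,
      forall x w, x \in C -> frac_cover e w -> n.*2 <= \sum_y w y * m y + w x
    & forall x, x \notin C -> n.*2 <= m x].

(** A violated cover is positive exactly on C, since large exponents force zeros
outside C and each variable in C repairs the violation. *)
Lemma critical_cover_supp n C m w : critical n C m -> frac_cover e w ->
  \sum_x w x * m x < n.*2 -> forall x, (0 < w x) = (x \in C).
Proof.
move=> [_ h1 h2] cw lt x; have [xC|xC] := boolP (x \in C).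
  by have := h1 x w xC cw; lia.
apply/negbTE; rewrite -eqn0Ngt; apply/negPn/negP => wx.
have : w x * m x <= \sum_x w x * m x by rewrite (bigD1 x) //= leq_addr.
have := h2 x xC; nia.
Qed.

Lemma sum_remainder X (F : T -> nat) : stable X ->
  \sum_x F x = \sum_(x in X) F x + \sum_(x in nbrs setT X) F x + \sum_(x in remainder X) F x.
Proof.
move=> stX; rewrite (bigID (mem (X :|: nbrs setT X))) /=; congr (_ + _); last first.
  by apply: eq_bigl => x; rewrite in_setC.
rewrite -bigU /=; first by apply: eq_bigl => x; rewrite !inE.
rewrite disjoints_subset; apply/subsetP=> x xX; rewrite inE; apply/nbrsP=> -[_ [y yX]].
by apply/negP; apply: stX.
Qed.

(** A violated cover vanishes on X and is 2 on the neighbours of X, so all the freedom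
is in the remainder W.  There the constant weight 1 must be violated by exactly
one, which fixes the total of m on W to be odd, and the covers lowered to 0 on an
independent set Y of W and raised to 2 on its neighbours give the expansion of m
on W.  Conversely an expanding weight is extended by large exponents on X.  When W
is empty, the exponent n - 1 on a single neighbour of X serves. *)
Lemma criticalP n X : 0 < n ->
  (exists m, critical n (~: X) m) <-> stable X /\ critical_size n (remainder X).
Proof.
move=> n0; split.
- case=> m cm; have [[w cw lt] h1 h2] := cm.
  have suppw x : (0 < w x) = (x \notin X) by rewrite (critical_cover_supp cm cw lt) inE.
  have stX : stable X.
    move=> x y xX yX; apply/negP=> /cw; have := suppw x; have := suppw y.
    by rewrite xX yX /=; lia.
  split=> //; set W := remainder X.
  have [->|[x0 x0W]] := set_0Vmem W; first by left.
  right; pose N := nbrs setT X.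
  (* The half-integral cover attached to an independent set Y of W. *)
  pose cov Y x := if x \in X then 0 else if x \in N then 2 else if x \in Y then 0
     else if x \in nbrs W Y then 2 else 1.
  have covP Y : Y \subset W -> stable Y -> frac_cover e (cov Y).
    move=> YW stY x y; wlog: x y / x \in X :|: Y.
      move=> hw exy; case: (boolP (x \in X :|: Y)) => xXY; first exact: hw.
      case: (boolP (y \in X :|: Y)) => yXY; first by rewrite addnC hw // e_sym.
      move: xXY yXY; rewrite /cov !in_setU !negb_or => /andP [/negPf -> /negPf ->] /andP
        [/negPf -> /negPf ->] /=.
      by case: (x \in N); case: (y \in N); case: (x \in nbrs _ _); case: (y \in nbrs _ _).
    rewrite in_setU => xXY exy; have [xX|xX] := boolP (x \in X).
      have yN : y \in N by apply/nbrsP; split; rewrite ?inE //; exists x.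
      have yX : y \notin X by apply: contraL exy => yX; apply: stX.
      by rewrite /cov (negPf yX) yN leq_addl.
    have xY : x \in Y by rewrite (negPf xX) in xXY.
    have yY : y \notin Y by apply: contraL exy => yX; apply: stY.
    have yX : y \notin X.
      apply/negP=> yX; have := subsetP YW _ xY; rewrite in_remainder => /andP [_ /negP []].
      by apply/nbrsP; split; rewrite ?in_setT //; exists y; rewrite // e_sym.
    rewrite /cov (negPf yX) (negPf yY); have [yN|yN] := boolP (y \in N);
      first by rewrite leq_addl.
    have -> : y \in nbrs W Y; last by rewrite leq_addl.
    by apply/nbrsP; split; [rewrite in_remainder yX -/N yN | exists x].
  have sum_cov Y : Y \subset W -> stable Y -> \sum_x cov Y x * m x + \sum_(x in Y) m x =
      (\sum_(x in N) m x).*2 + \sum_(x in W) m x + \sum_(x in nbrs W Y) m x.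
    move=> YW stY; rewrite (sum_remainder _ stX) /= big1 => [|x xX]; last by rewrite /cov xX.
    rewrite add0n -!addnA; congr (_ + _).
      rewrite -mul2n big_distrr; apply: eq_bigr => x xN; rewrite /cov xN ifN //.
      by apply/negP=> xX; case/nbrsP: xN => _ [y yX]; apply/negP/stX.
    have mk (Z : {set T}) : Z \subset W -> \sum_(x in Z) m x = \sum_(x in W) (x \in Z) * m x.
      move=> ZW; rewrite big_mkcond [RHS]big_mkcond; apply: eq_bigr => x _.
      by case: (boolP (x \in Z)) => [/(subsetP ZW) ->|]; rewrite ?mul1n ?mul0n ?if_same.
    have NW : nbrs W Y \subset W by apply/subsetP => y /nbrsP [].
    rewrite (mk Y) // (mk (nbrs W Y)) // -!big_split; apply: eq_bigr => x xW /=.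
    move: (xW); rewrite in_remainder -/N /cov => /andP [/negPf -> /negPf ->].
    have [xY|xY] := boolP (x \in Y).
      rewrite (_ : x \in nbrs W Y = false) ?mul0n ?mul1n ?addn0 ?add0n //.
      by apply/nbrsP=> -[_ [y yY]]; apply/negP/stY.
    by case: ifP => _; rewrite ?mul2n ?mul1n ?mul0n ?addnn ?addn0.
  have sub0 : set0 \subset W by apply: sub0set.
  have st0 : stable set0 by move=> x; rewrite inE.
  (* The case of the empty Y pins the total of m on W down to 2n' - 1. *)
  have s0 := sum_cov _ sub0 st0.
  have n00 : nbrs W set0 = set0.
    by apply/setP=> x; rewrite in_set0; apply/negbTE/nbrsP=> -[_ [y]]; rewrite inE.
  rewrite n00 !big_set0 !addn0 in s0.
  have le0 : \sum_x cov set0 x * m x < n.*2.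
    apply: leq_ltn_trans lt; apply: leq_sum => x _; rewrite leq_mul2r; apply/orP; right.
    rewrite /cov n00 !in_set0 /=; case: ifP => // xX; have := suppw x; rewrite xX /= => wx.
    case: ifP => // /nbrsP [_ [y yX eyx]].
    by have := cw _ _ eyx; have := suppw y; rewrite yX /=; lia.
  have x0C : x0 \in ~: X by move: x0W; rewrite in_remainder in_setC => /andP [].
  have := h1 x0 _ x0C (covP _ sub0 st0).
  have -> : cov set0 x0 = 1.
    by move: x0W; rewrite /cov n00 !in_set0 in_remainder -/N => /andP [/negPf -> /negPf ->].
  move=> ge0.
  have bsum : (\sum_(x in W) m x).+1 = (n - \sum_(x in N) m x).*2 by lia.
  have : critical_size (n - \sum_(x in N) m x) W.
    right; exists m => // Y YW Y0 stY; have [y yY] := set0Pn _ Y0.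
    have yW := subsetP YW _ yY.
    have yC : y \in ~: X by move: yW; rewrite in_remainder in_setC => /andP [].
    have := h1 y _ yC (covP _ YW stY); have := sum_cov _ YW stY.
    have -> : cov Y y = 0.
      by move: yW; rewrite /cov yY in_remainder -/N => /andP [/negPf -> /negPf ->].
    lia.
  move/(critical_size_le (leq_subr (\sum_(x in N) m x) n)); case=> [W0|//].
  by rewrite -/W W0 inE in x0W.
- case=> stX hW; set W := remainder X in hW; pose N := nbrs setT X.
  have disj x : [/\ (x \in N -> x \notin X), (x \in W -> x \notin X) & (x \in W -> x \notin N)].
    rewrite in_remainder -/N; split; [|by case/andP|by case/andP].
    by move=> /nbrsP [_ [y yX eyx]]; apply/negP=> xX; have := stX _ _ yX xX; rewrite eyx.
  have [b [c [hb bc]]] : exists b c, [/\ forall w, frac_cover e w ->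
         (forall x, x \in X -> w x = 0) -> forall x, x \in ~: X -> n.*2 <=
         \sum_(x in N) w x * c x + \sum_(x in W) w x * b x + w x
       & (\sum_(x in N) c x).*2 + \sum_(x in W) b x < n.*2].
    have w2 w x : frac_cover e w -> (forall x, x \in X -> w x = 0) -> x \in N -> 2 <= w x.
      by move=> cw w0 /nbrsP [_ [y yX /cw]]; rewrite w0.
    case: hW => [W0|[b hb bn]]; last first.
      exists b, (fun _ => 0); split; last by rewrite big1 //; lia.
      move=> w cw w0 x xX; rewrite big1 ?add0n => [|y _]; last by rewrite muln0.
      have := expanding_cover hb cw; case: (boolP [exists y in W, w y == 0]) => [_|ne];
        first by rewrite /=; lia.
      move=> h; suff : 0 < w x by lia.
      rewrite lt0n; apply/negP=> wx; case: (boolP (x \in W)) => xW.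
        by case/existsP: ne; exists x; rewrite xW.
      have xN : x \in N by move: xW xX; rewrite in_remainder in_setC => /nandP [/negPf -> //|];
        rewrite negbK.
      by have := w2 w x cw w0 xN; rewrite (eqP wx).
    have [C0|[x0 x0C]] := set_0Vmem (~: X).
      exists (fun _ => 0), (fun _ => 0); split; last by rewrite !big1 //; lia.
      by move=> w _ _ x; rewrite C0 inE.
    have CN x : x \in ~: X -> x \in N.
      move=> xX; apply/negPn/negP => xN;
        have : x \in W by rewrite in_remainder -/N xN andbT -in_setC.
      by rewrite W0 inE.
    exists (fun _ => 0), (fun x => (n.-1) * (x == x0)); split; last first.
      rewrite [X in _ + X]big1 // (bigD1 x0) ?CN //= eqxx big1 => [|y /andP [_ /negPf ->]]; lia.
    move=> w cw w0 x xX; have wx := w2 w x cw w0 (CN x xX).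
    rewrite W0 big_set0 (bigD1 x0) ?CN //= eqxx muln1.
    have := w2 w x0 cw w0 (CN x0 x0C); nia.
  pose m x := if x \in X then n.*2 else if x \in N then c x else b x.
  have smm w : \sum_x w x * m x = \sum_(x in X) w x * n.*2 + \sum_(x in N) w x * c x + \sum_(x
    in W) w x * b x.
    rewrite (sum_remainder _ stX) -/W -/N /m; congr (_ + _ + _); apply: eq_bigr => x hx.
    - by rewrite hx.
    - by case: (disj x) => /(_ hx) /negPf -> _ _; rewrite hx.
    - by case: (disj x) => _ /(_ hx) /negPf -> /(_ hx) /negPf ->.
  exists m; split.
  + exists (fun x => if x \in X then 0 else if x \in N then 2 else 1).
      move=> x y; wlog xX : x y / x \in X.
        move=> hw exy; case: (boolP (x \in X)) => xX; first by have := hw x y xX exy; rewrite xX.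
        case: (boolP (y \in X)) => yX; last by do 2!case: ifP.
        by have := hw y x yX; rewrite e_sym => /(_ exy); rewrite yX (negPf xX) addnC.
      move=> exy; have yN : y \in N by apply/nbrsP; split; rewrite ?inE //; exists x.
      by case: (disj y) => /(_ yN) /negPf -> _ _; rewrite yN; lia.
    rewrite smm big1 => [|x ->] //; apply: leq_ltn_trans bc; rewrite add0n; apply: leq_add.
      rewrite -mul2n big_distrr; apply: leq_sum => x xN.
      by case: (disj x) => /(_ xN) /negPf -> _ _; rewrite xN.
    apply: leq_sum => x xW; case: (disj x) => _ /(_ xW) /negPf -> /(_ xW) /negPf ->.
    by rewrite mul1n.
  + move=> x w xC cw; rewrite smm.
    case: (boolP [exists y in X, 0 < w y]) => [/existsP [y /andP [yX wy]]|ne].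
      by rewrite (bigD1 y) //=; nia.
    have w0 y : y \in X -> w y = 0.
      move=> yX; apply/eqP; rewrite eqn0Ngt; apply: contra ne => wy.
      by apply/existsP; exists y; rewrite yX.
    have := hb w cw w0 x xC; lia.
  + by move=> x; rewrite inE negbK /m => ->.
Qed.

End Expanding.

(** * Associated primes *)

Section AssociatedPrimes.
Local Open Scope ring_scope.
Variables (K : fieldType) (r : nat) (e : rel 'I_r).
Hypotheses (e_sym : ssrbool.symmetric e) (e_irr : irreflexive e).
Implicit Types (f g : {mpoly K[r]}) (m : 'X_{1..r}) (C : {set 'I_r}).
Notation I := (edge_ideal K e).

Definition monomial_prime C f : Prop :=
  forall m, m \in msupp f -> exists2 i, i \in C & (0 < m i)%N.

Lemma monomial_primeX C i : monomial_prime C ('X_i : {mpoly K[r]}) <-> i \in C.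
Proof.
split=> [h | iC m].
  have [|j jC] := h U_(i)%MM; first by rewrite msuppX inE.
  by rewrite mnm1E; case: eqP jC => // ->.
by rewrite msuppX inE => /eqP ->; exists i; rewrite // mnm1E eqxx.
Qed.

Lemma wt_gt0 C (w : 'I_r -> nat) m : (forall x, (0 < w x)%N = (x \in C)) ->
  (0 < wt w m)%N <-> exists2 i, i \in C & (0 < m i)%N.
Proof.
move=> wC; split=> [|[i iC mi]].
  rewrite lt0n sum_nat_eq0 negb_forall => /existsP [i]; rewrite muln_eq0 negb_or -!lt0n wC.
  by case/andP; exists i.
by rewrite /wt (bigD1 i) //= addn_gt0 muln_gt0 wC iC mi.
Qed.

(** For a weight with support C, the prime is the kernel of taking the constant
coefficient of the graded substitution, a morphism to an integral domain. *)
Lemma monomial_primeE C w f : (forall x, (0 < w x)%N = (x \in C)) ->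
  monomial_prime C f <-> (graded_subst w f)`_0 = 0.
Proof.
move=> wC; have E : vanish 1 (graded_subst w f) <-> (graded_subst w f)`_0 = 0.
  by split=> [-> // | h [|]].
rewrite -E vanish_graded_subst; split=> h m /h; by rewrite (wt_gt0 _ wC).
Qed.

Lemma monomial_prime_prime C : is_prime_ideal (@monomial_prime C).
Proof.
pose w x : nat := x \in C.
have wC x : (0 < w x)%N = (x \in C) by rewrite lt0b.
split; first split.
- by move=> m; rewrite msupp0.
- move=> f g; rewrite !(monomial_primeE _ wC) rmorphD coefD => -> ->; exact: addr0.
- move=> f g; rewrite !(monomial_primeE _ wC) rmorphM coef0M => ->; exact: mulr0.
- by rewrite (monomial_primeE _ wC) rmorph1 coef1 => /eqP; rewrite oner_eq0.
- move=> f g; rewrite !(monomial_primeE _ wC) rmorphM coef0M => /eqP.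
  by rewrite mulf_eq0 => /orP [/eqP|/eqP]; [left|right].
Qed.

Lemma prime_mnm (P : {mpoly K[r]} -> Prop) m : is_prime_ideal P -> P 'X_[m] ->
  exists2 i, P 'X_i & (0 < m i)%N.
Proof.
case=> [[P0 PD PM] P1 Pmul]; rewrite mpolyXE_id.
have : forall s : seq 'I_r, P (\prod_(i <- s) 'X_i ^+ m i) ->
    exists2 i, P 'X_i & (0 < m i)%N.
  elim=> [|i s IHs]; first by rewrite big_nil.
  rewrite big_cons => /Pmul [|/IHs //].
  have : forall k, (k <= m i)%N -> P ('X_i ^+ k) -> exists2 j, P 'X_j & (0 < m j)%N.
    elim=> [|k IHk] km; first by rewrite expr0.
    by rewrite exprS => /Pmul [Pi|/IHk]; [exists i => //; lia | apply; lia].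
  exact.
exact.
Qed.

Lemma newtonD n m m' : newton e n m -> newton e n (m + m')%MM.
Proof. by move=> h w cw; rewrite wtD; apply: leq_trans (h w cw) _; apply: leq_addr. Qed.

(** From a polynomial f whose colon ideal is the prime P, pass to a monomial of z f,
where z is a high power of the product of the variables outside P.  Primality of P
keeps z f outside the closure.  An element of P with a monomial free of variables
in P would have order zero for the violated cover, hence could be cancelled from
the product with z f. *)
Lemma Ass_closure_critical n P : Ass (integral_closure (ideal_pow I n)) P <->
  exists C, (exists m : 'I_r -> nat, critical e n C m) /\
            forall f, P f <-> monomial_prime C f.
Proof.
split; last first.
  move=> [C [[m0 cm] PC]]; pose m : 'X_{1..r} := [multinom m0 i | i < r].
  have wtm w : wt w m = (\sum_x w x * m0 x)%N.
    by apply: eq_bigr => i _; rewrite mnmE.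
  have [[w cw lt] h1 h2] := cm.
  have wC := critical_cover_supp cm cw lt.
  have [[p0 pD pM] p1 pmul] := monomial_prime_prime C.
  split.
    split; [split | by rewrite PC | by move=> f g; rewrite !PC; apply: pmul].
    - by rewrite PC.
    - by move=> f g; rewrite !PC; apply: pD.
    - by move=> a f; rewrite !PC; apply: pM.
  exists 'X_[m] => f; rewrite PC integral_closure_powP //; split=> [hf k | h k kf].
    rewrite (perm_mem (msuppMX _ _)) => /mapP [k' /hf [i iC ki] ->].
    have -> : (m + k' = (m + U_(i)) + (k' - U_(i)))%MM.
      apply/mnmP=> j; rewrite !(mnmDE, mnmBE) mnm1E; case: eqP => [<-|_]; lia.
    apply: newtonD => v cv; rewrite wtD wtU wtm; exact: h1.
  apply/(wt_gt0 _ wC).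
  have : (n.*2 <= wt w (m + k)%MM)%N.
    by apply: h => //; rewrite (perm_mem (msuppMX _ _)) map_f.
  rewrite wtD wtm; move: lt; lia.
move=> [Pprime [f Pf]]; have [[P0 PD PM] P1 Pmul] := Pprime.
have [c hc] : exists c : 'I_r -> bool, forall i, c i <-> P 'X_i.
  apply: (@fin_all_exists _ (fun _ => bool) (fun i b => b <-> P 'X_i)) => i.
  by case: (classic (P 'X_i)) => h; [exists true | exists false].
pose C := [set i | c i].
have inC i : i \in C <-> P 'X_i by rewrite inE.
pose z : 'X_{1..r} := [multinom if i \in C then 0%N else n.*2 | i < r].
have zP : ~ P 'X_[z].
  by move=> /(prime_mnm Pprime) [i /inC iC]; rewrite mnmE iC.
have [m [mz nm]] : exists m, m \in msupp ('X_[z] * f) /\ ~ newton e n m.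
  apply: NNPP => no; apply: zP; apply/Pf/integral_closure_powP => // m mz.
  by apply: NNPP => nm; apply: no; exists m.
have [w [cw lt]] : exists w, frac_cover e w /\ (wt w m < n.*2)%N.
  apply: NNPP => no; apply: nm => w cw; rewrite leqNgt; apply/negP => lt.
  by apply: no; exists w.
have cm : critical e n C m.
  split; first by exists w.
    move=> i v /inC Pi cv; rewrite -/(wt v m) -wtU -wtD.
    have /Pf/integral_closure_powP h := PM 'X_[z] _ Pi; apply: h => //.
    rewrite mulrAC (perm_mem (msuppMX _ _)) addmC; exact: map_f.
  move=> i iC; move: mz; rewrite mulrC (perm_mem (msuppMX _ _)) => /mapP [k _ ->].
  by rewrite mnmDE mnmE (negPf iC) leq_addr.
have wC := critical_cover_supp cm cw lt.
exists C; split; first by exists m.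
move=> g; split; last first.
  move=> hg; rewrite [g]mpolyE big_seq; apply: ideal_sum => // k /hg [i /inC Pi ki].
  rewrite -mul_mpolyC; apply: (PM); have -> : (k = (k - U_(i)) + U_(i))%MM.
    by apply/mnmP=> j; rewrite mnmDE mnmBE mnm1E; case: eqP => [<-|_]; lia.
  by rewrite mpolyXD; apply: PM.
move=> Pg; rewrite (monomial_primeE _ wC); apply/eqP/negPn/negP => g0.
have /Pf/integral_closure_powP cl := PM 'X_[z] _ Pg.
have : vanish n.*2 (graded_subst w ('X_[z] * f)).
  apply: (vanish_cancel _ g0); rewrite -rmorphM mulrCA mulrA.
  by apply/vanish_graded_subst => k kf; apply: cl.
by move/vanish_graded_subst => /(_ m mz); move: lt; rewrite -/(wt w m); lia.
Qed.

Lemma Ass_closureP n P : (0 < n)%N -> Ass (integral_closure (ideal_pow I n)) P <->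
  exists X : {set 'I_r}, [/\ stable e X, critical_size e n (remainder e X) &
    forall f, P f <-> monomial_prime (~: X) f].
Proof.
move=> n0; rewrite Ass_closure_critical; split=> [[C [cm PC]] | [X [stX cX PX]]].
  by exists (~: C); move: cm; rewrite -{1}[C]setCK criticalP // => -[? ?]; rewrite setCK.
by exists (~: X); rewrite criticalP.
Qed.

End AssociatedPrimes.

(** * Components and odd cycles *)

Section Components.
Variables (T : finType) (e : rel T).
Hypotheses (e_sym : ssrbool.symmetric e) (e_irr : irreflexive e).
Implicit Types (x y u v z : T) (S C W X Y : {set T}) (c : seq T).

(** On a closed set S the classes of [components e S] are of this form, which makes
them independent of S. *)
Definition component_of x : {set T} := [set y | connect e x y].
Definition closed_set S : Prop := forall x y, x \in S -> e x y -> y \in S.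

Lemma connect_symmetric : connect_sym e.
Proof. exact: sym_connect_sym. Qed.

Lemma component_of_refl x : x \in component_of x.
Proof. by rewrite inE. Qed.

Lemma component_of_eq x y : y \in component_of x -> component_of y = component_of x.
Proof.
by rewrite inE => xy; apply/setP=> z; rewrite !inE (same_connect connect_symmetric xy).
Qed.

Lemma component_of_closed x : closed_set (component_of x).
Proof. by move=> y z; rewrite !inE => xy yz; apply: connect_trans xy (connect1 yz). Qed.

Lemma component_of_sub S x : closed_set S -> x \in S -> component_of x \subset S.
Proof.
move=> clS xS; apply/subsetP=> y; rewrite inE => /connectP [p].
by elim: p x xS => [|z p IHp] x xS /= => [_ -> //|/andP [xz]]; apply/IHp/(clS x).
Qed.

Lemma components_closed S : closed_set S -> components e S = component_of @: S.
Proof.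
move=> clS; apply: eq_in_imset => x xS; apply/setP=> y; rewrite !inE.
apply/andP/idP=> [[_]|xy].
  by apply: connect_sub => u v /and3P [_ _ /connect1].
split; first by apply: (subsetP (component_of_sub clS xS)); rewrite inE.
case/connectP: xy => p; elim: p x xS => [|z p IHp] x xS /= => [_ -> //|/andP [xz pth lst]].
have zS := clS x z xS xz; apply: connect_trans (connect1 _) (IHp z zS pth lst).
by rewrite /induced /= xS zS.
Qed.

Lemma componentsT : components e setT = component_of @: setT.
Proof. by apply: components_closed => x y _ _; rewrite inE. Qed.

Lemma componentsP C : reflect (exists x, C = component_of x) (C \in components e setT).
Proof.
rewrite componentsT; apply: (iffP imsetP) => [[x _ ->]|[x ->]]; first by exists x.
by exists x.
Qed.

Lemma component_eq C x : C \in components e setT -> x \in C -> C = component_of x.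
Proof. by case/componentsP=> y -> /component_of_eq ->. Qed.

Lemma component_closed C : C \in components e setT -> closed_set C.
Proof. by case/componentsP=> x ->; apply: component_of_closed. Qed.

Lemma cover_closed (P : {set {set T}}) : P \subset components e setT -> closed_set (cover P).
Proof.
move=> /subsetP sP x y /bigcupP [C CP xC] xy; apply/bigcupP; exists C => //.
by apply: (component_closed (sP C CP)) xy.
Qed.

Lemma component_sub_cover (P : {set {set T}}) C : C \in P -> C \subset cover P.
Proof. by move=> CP; apply: (bigcup_sup C). Qed.

Lemma components_cover (P : {set {set T}}) : P \subset components e setT ->
  components e (cover P) = P.
Proof.
move=> sP; rewrite components_closed; last exact: cover_closed.
have sP' := subsetP sP; apply/setP=> C; apply/imsetP/idP=> [[x /bigcupP [D DP xD] ->]|CP].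
  by rewrite -(component_eq (sP' _ DP) xD).
have /componentsP [x Cx] := sP' C CP; exists x => //.
by apply/bigcupP; exists C => //; rewrite Cx component_of_refl.
Qed.

Lemma components_trivIset (P : {set {set T}}) : P \subset components e setT -> trivIset P.
Proof.
move=> /subsetP sP; apply/trivIsetP=> A B AP BP; apply: contraR => /pred0Pn [x /andP [xA xB]].
by rewrite (component_eq (sP A AP) xA) (component_eq (sP B BP) xB).
Qed.

Lemma sum_cover (P : {set {set T}}) (F : T -> nat) : P \subset components e setT ->
  \sum_(x in cover P) F x = \sum_(C in P) \sum_(x in C) F x.
Proof. by move=> sP; rewrite big_trivIset //; apply: components_trivIset. Qed.

Lemma card_cycle_edges c : uniq c -> 2 < size c -> #|cycle_edges c| = size c.
Proof.
move=> Uc sz; have inj : {in c &, injective (fun x => [set x; next c x])}.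
  move=> x y xc yc /setP h; apply/eqP/negPn/negP => nxy.
  have := h x; rewrite !inE eqxx (negPf nxy) /= => /esym/eqP xy.
  have := h y; rewrite !inE eqxx eq_sym (negPf nxy) /= => /eqP yx.
  have fc := cycle_next Uc; have := order_cycle fc Uc xc.
  have : order (next c) x <= #|[set x; y]|.
    apply: subset_leq_card; apply/subsetP => z; rewrite inE => /iter_findex <-.
    elim: (findex _ _ _) => [|k]; first by rewrite !inE eqxx.
    by rewrite !inE iterS => /orP [] /eqP ->; rewrite -?yx -?xy eqxx ?orbT.
  rewrite cards2 nxy; lia.
by rewrite card_in_imset //; apply/card_uniqP.
Qed.

Lemma is_cycleW S S' c : S \subset S' -> is_cycle e S c -> is_cycle e S' c.
Proof.
move=> sS /and3P [sz uc /allP cS]; apply/and3P; split=> //.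
by apply/allP=> x /cS /(subsetP sS).
Qed.

Lemma is_cycle_comp S c x : is_cycle e S c -> x \in c -> is_cycle e (component_of x) c.
Proof.
move=> /and3P [sz /andP [cc uc] cS] xc; apply/and3P; split; rewrite /ucycleb ?cc ?uc //.
case: c cc xc {sz uc cS} => // a p cc xc.
have h y : y \in a :: p -> connect e a y.
  rewrite inE => /orP [/eqP -> //|yp]; apply: (path_connect (p := rcons p a)) => //.
  by rewrite inE mem_rcons !inE yp !orbT.
by apply/allP=> y yp; rewrite /= inE; apply: connect_trans (h y yp); rewrite connect_symmetric h.
Qed.

(** The default value d takes part in the minimum, so it is the result when no index
qualifies or when d lies below all values. *)
Lemma bigmin_leP (I : eqType) (s : seq I) (P : pred I) (F : I -> nat) d :
  (forall i, i \in s -> P i -> \big[minn/d]_(i <- s | P i) F i <= F i) /\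
  ((exists i, [/\ i \in s, P i & \big[minn/d]_(i <- s | P i) F i = F i]) \/
    \big[minn/d]_(i <- s | P i) F i = d).
Proof.
elim: s => [|j s [IH1 IH2]]; first by split=> //; right; rewrite big_nil.
rewrite big_cons; case: ifP => Pj; split.
- move=> i; rewrite inE => /orP [/eqP ->|si] Pi; first by rewrite geq_minl.
  by apply: leq_trans (geq_minr _ _) (IH1 i si Pi).
- rewrite /minn; case: ifP => _; first by left; exists j; rewrite mem_head.
  case: IH2 => [[i [si Pi Ei]]|->]; last by right.
  by left; exists i; rewrite inE si orbT.
- by move=> i; rewrite inE => /orP [/eqP ->|]; [rewrite Pj | apply: IH1].
- case: IH2 => [[i [si Pi Ei]]|->]; last by right.
  by left; exists i; rewrite inE si orbT.
Qed.

Lemma odd_girth_le S c : is_cycle e S c -> odd (size c) -> odd_girth e S <= size c.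
Proof.
move=> cS oc; have szT : size c < #|T|.+1.
  case/and3P: cS => _ /andP [_ /card_uniqP <-] _; rewrite ltnS; exact: max_card.
have [h _] := bigmin_leP (index_enum 'I_#|T|.+1) (has_odd_cycle e S) (@nat_of_ord _) #|T|.+1.
apply: (h (Ordinal szT)); first exact: mem_index_enum.
by rewrite /has_odd_cycle /= oc; apply/existsP; exists (in_tuple c).
Qed.

Lemma odd_girth_attained S c : is_cycle e S c -> odd (size c) ->
  exists c', [/\ is_cycle e S c', odd (size c') & odd_girth e S = size c'].
Proof.
move=> cS oc.
have [_ [[n [_ /andP [on /existsP [t ct]] E]]|E]] :=
    bigmin_leP (index_enum 'I_#|T|.+1) (has_odd_cycle e S) (@nat_of_ord _) #|T|.+1.
  by exists t; rewrite size_tuple.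
have := odd_girth_le cS oc; rewrite /odd_girth E.
case/and3P: cS => _ /andP [_ /card_uniqP <-] _ h.
by have := leq_trans h (max_card (mem c)); rewrite ltnn.
Qed.

Lemma odd_girth_sub S S' c : S \subset S' -> is_cycle e S c -> odd (size c) ->
  odd_girth e S' <= odd_girth e S.
Proof.
move=> sS cS oc; have [c' [cS' oc' ->]] := odd_girth_attained cS oc.
by apply: odd_girth_le oc'; apply: is_cycleW cS'.
Qed.

End Components.

(** * Nonbipartite components of pseudoforests are functional graphs *)

Section FunctionalStructure.
Variables (T : finType) (e : rel T).
Hypotheses (e_sym : ssrbool.symmetric e) (e_irr : irreflexive e).
Implicit Types (x y u v z : T) (S C W X Y : {set T}) (c : seq T) (f : T -> T).

(** Every edge is {v, f v} for one vertex v, which is unique as f has no 2-cycle,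
and following f leads to the root z, which lies on the cycle of f. *)
Record functional_graph C f z : Prop := Functional {
  functional_root : z \in C;
  functional_closed : forall v, v \in C -> f v \in C;
  functional_edge : forall v, v \in C -> e v (f v);
  functional_edges : forall u v, u \in C -> v \in C -> e u v -> v = f u \/ u = f v;
  functional_no2cycle : forall v, v \in C -> f (f v) != v;
  functional_conn : forall u, u \in C -> fconnect f u z }.

Lemma findexS f u v : fconnect f u v -> u != v -> findex f u v = (findex f (f u) v).+1.
Proof. by move=> uv ne; apply: fconnect_findex; rewrite // eq_sym. Qed.

Lemma findex_cycle f z : fconnect f (f z) z -> findex f (f z) z = (order f z).-1.
Proof.
move=> cyc; have oz : order f (f z) = order f z by apply: (all_iffLR orbitPcycle 2 1).
have lt : (order f z).-1 < order f (f z) by rewrite oz orderSpred.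
have := findex_iter lt; rewrite -iterSr orderSpred.
by have -> : iter (order f z) f z = z by apply: (all_iffLR orbitPcycle 2 4).
Qed.

(** A step of a breadth-first search tree directed towards Q. *)
Lemma nearest_map C (Q : pred T) z : C \in components e setT -> z \in C -> Q z ->
  exists d (g : T -> T), forall v, v \in C -> ~~ Q v ->
    [/\ g v \in C, e v (g v) & d (g v) < d v].
Proof.
move=> Ccomp zC Qz.
pose reach v n := [exists t : n.-tuple T, path e v t && Q (last v t)].
have exd v : exists n, v \in C -> reach v n /\ forall m, reach v m -> n <= m.
  have [vC|] := boolP (v \in C); last by exists 0.
  have : exists n, reach v n.
    have : z \in component_of e v by rewrite -(component_eq e_sym Ccomp vC).
    rewrite inE => /connectP [p vp zp]; exists (size p); apply/existsP; exists (in_tuple p).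
    by rewrite vp -zp.
  by move=> exn; exists (ex_minn exn) => _; case: ex_minnP.
have [d hd] := fin_all_exists exd.
have exg v : exists u, v \in C -> ~~ Q v -> [/\ u \in C, e v u & d u < d v].
  have [vC|] := boolP (v \in C); last by exists v.
  have [Qv|nQv] := boolP (Q v); first by exists v.
  have [/existsP [[[|u p] /= sz] hp] _] := hd v vC; first by rewrite hp in nQv.
  case/andP: hp => /andP [vu pth] Ql; exists u => _ _.
  have uC := component_closed Ccomp vC vu; split=> //.
  have [_ /(_ (size p)) h] := hd u uC; move/eqP: sz => <-; rewrite ltnS h //.
  by apply/existsP; exists (in_tuple p); rewrite pth.
by have [g hg] := fin_all_exists exg; exists d, g => v vC nQ; apply: hg.
Qed.

(** The ends of an edge that is not of the form {x, f x} are joined by a path of such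
edges through z, and the edge closes a simple such path to a cycle. *)
Lemma extra_edge_cycle C f z u v :
  (forall x, x \in C -> f x \in C) -> (forall x, x \in C -> f x = x \/ e x (f x)) ->
  (forall x, x \in C -> fconnect f x z) ->
  u \in C -> v \in C -> e u v -> v != f u -> u != f v ->
  exists2 c, is_cycle e C c & [set u; v] \in cycle_edges c.
Proof.
move=> fC fe fz uC vC euv vfu ufv.
pose e' x y := [&& x \in C, y \in C, e x y & (y == f x) || (x == f y)].
have e'_sym : ssrbool.symmetric e'.
  by move=> x y; rewrite /e' e_sym orbC; case: (x \in C); case: (y \in C).
have e'z x : x \in C -> connect e' x z.
  move=> xC; rewrite -(iter_findex (fz x xC)); elim: (findex f x z) => //= k IHk.
  apply: connect_trans IHk _; have kC : iter k f x \in C by elim: k => //= k; apply: fC.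
  case: (fe _ kC) => [-> //|ek]; apply: connect1; by rewrite /e' kC fC // ek eqxx.
have : connect e' u v.
  by apply: connect_trans (e'z u uC) _; rewrite (sym_connect_sym e'_sym) e'z.
case/connectP=> p0 /shortenP [p pth up _] {p0} lst.
exists (u :: p).
  apply/and3P; split.
  - case: p pth up lst => [_ _ vu|y [|? ?] //]; first by rewrite vu e_irr in euv.
    by rewrite /= andbT => /and4P [_ _ _ h] _ yv; move: h; rewrite -yv (negPf vfu) (negPf ufv).
  - rewrite /ucycleb up andbT /= rcons_path -lst e_sym euv andbT.
    by apply: sub_path pth => x y /and4P [].
  - rewrite /= uC /=; elim: p u uC pth {up lst euv vfu ufv} => //= y p IHp x xC /andP [/and4P
    [_ yC _ _]].
    by rewrite yC /=; apply: IHp.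
apply/imsetP; exists v; first by rewrite lst mem_last.
rewrite next_nth ifT; last by rewrite lst mem_last.
by rewrite lst index_last // nth_default // setUC.
Qed.

(** A step of f lowers the distance to z by one except at z itself, so the parity of
the distance is a proper colouring away from z. *)
Lemma odd_findex_bipartite C f z (A := [set u | odd (findex f u z)]) :
  (forall u v, u \in C -> v \in C -> e u v -> v = f u \/ u = f v) ->
  (forall u, u \in C -> fconnect f u z) ->
  forall u v, u \in C -> v \in C -> e u v -> u != z -> v != z -> (u \in A) != (v \in A).
Proof.
move=> fall fz u v uC vC euv uz vz; rewrite !inE; case: (fall u v uC vC euv) => E.
  by rewrite (findexS (fz u uC) uz) -E /=; case: odd.
by rewrite (findexS (fz v vC) vz) -E /=; case: odd.
Qed.

(** In a tree a breadth-first search uses every edge, by [extra_edge_cycle], and the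
parity of the distance to the root is a bipartition. *)
Lemma nonbipartite_not_tree C : C \in components e setT -> ~~ bipartite e C -> ~ is_tree e C.
Proof.
move=> Ccomp nbip [[C0 _] acyc]; case/set0Pn: C0 => z zC.
have [d [g hg]] := @nearest_map C (pred1 z) z Ccomp zC (eqxx z).
pose f v := if v == z then z else g v.
have fC x : x \in C -> f x \in C.
  by move=> xC; rewrite /f; case: eqVneq => // xz; case: (hg x xC xz).
have fe x : x \in C -> f x = x \/ e x (f x).
  by move=> xC; rewrite /f; case: eqVneq => [->|xz]; [left | right; case: (hg x xC xz)].
have fz x : x \in C -> fconnect f x z.
  elim/ltn_ind: (d x) {-2}x (erefl (d x)) => n IH {}x dx xC.
  have [->|xz] := eqVneq x z; first exact: connect0.
  have [gC xg lt] := hg x xC xz; have fx : f x = g x by rewrite /f (negPf xz).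
   by rewrite dx in lt; rewrite fconnect_eqVf fx (IH _ lt) ?orbT.
have fall u v : u \in C -> v \in C -> e u v -> v = f u \/ u = f v.
  move=> uC vC euv; have [->|vf] := eqVneq v (f u); first by left.
  have [->|uf] := eqVneq u (f v); first by right.
  by have [c /(negP (acyc c))] := extra_edge_cycle fC fe fz uC vC euv vf uf.
case/negP: nbip; apply/existsP; exists [set u | odd (findex f u z)].
apply/forallP=> u; apply/implyP=> uC; apply/forallP=> v; apply/implyP=> vC; apply/implyP=> euv.
have fzz : f z = z by rewrite /f eqxx.
have ne : u != v by apply: contraL euv => /eqP ->; rewrite e_irr.
case: (fall u v uC vC euv) => E.
  have uz : u != z by apply: contra ne => /eqP uz; rewrite E uz fzz.
  by rewrite !inE (findexS (fz u uC) uz) -E /=; case: odd.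
have vz : v != z by apply: contra ne => /eqP vz; rewrite E vz fzz.
by rewrite !inE (findexS (fz v vC) vz) -E /=; case: odd.
Qed.

(** With an even cycle the parity of the distance to z also changes along the edge
from z to f z, which starts at distance zero and ends at distance order - 1. *)
Lemma functional_even_bipartite C f z : functional_graph C f z -> ~~ odd (order f z) ->
  bipartite e C.
Proof.
move=> [zC fC fe fall finv fz] ev.
have lastz : odd (findex f (f z) z).
  rewrite findex_cycle; last exact/fz/fC.
  by case: (order f z) (order_gt0 f z) ev => //= n _; rewrite negbK.
apply/existsP; exists [set u | odd (findex f u z)].
apply/forallP=> u; apply/implyP=> uC; apply/forallP=> v; apply/implyP=> vC; apply/implyP=> euv.
have ok x : x \in C -> (x \in [set u | odd (findex f u z)]) != (f x \in [set u | odd (findex f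
  u z)]).
  move=> xC; rewrite !inE; have [->|xz] := eqVneq x z; first by rewrite lastz findex0.
  by rewrite (findexS (fz x xC) xz) /=; case: odd.
by case: (fall u v uC vC euv) => ->; [| rewrite eq_sym]; apply: ok.
Qed.

(** The map f follows the cycle on its vertices and moves towards the cycle
elsewhere.  An edge not used by f would lie on a second cycle. *)
Lemma nonbipartite_functional C : C \in components e setT -> ~~ bipartite e C ->
  is_tree e C \/ is_unicyclic e C ->
  exists f z, [/\ functional_graph C f z, odd (order f z), (half_odd_girth e C).*2 =
    (order f z).+1
    & exists2 c, is_cycle e C c & odd (size c)].
Proof.
move=> Ccomp nbip [/(nonbipartite_not_tree Ccomp nbip) //|[_ [c cC uniqc]]].
have [szc /andP [cyc uc] /allP cin] := and3P cC.
have [z zc] : exists z, z \in c by case: (c) szc => // z ? _; exists z; rewrite mem_head.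
have zC : z \in C := cin z zc.
have [d [g hg]] := @nearest_map C (mem c) z Ccomp zC zc.
pose f v := if v \in c then next c v else g v.
have fcC x : x \in c -> f x \in c by move=> xc; rewrite /f xc mem_next.
have fC x : x \in C -> f x \in C.
  move=> xC; have [xc|xc] := boolP (x \in c); first by apply/cin/fcC.
  by rewrite /f (negPf xc); case: (hg x xC xc).
have fe x : x \in C -> e x (f x).
  move=> xC; rewrite /f; case: ifP => [xc|/negbT xc]; first exact: next_cycle.
  by case: (hg x xC xc).
(* f is the successor map on c, so orbits on c have the length of c. *)
have fcyc : fcycle f c.
  rewrite (eq_in_cycle (P := mem c) (e' := frel (next c))); first exact: cycle_next.
    by move=> x y xc _ /=; rewrite /f (xc : x \in c).
  exact/allP.
have ordc x : x \in c -> order f x = size c by move=> xc; apply: order_cycle.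
have fz x : x \in C -> fconnect f x z.
  elim/ltn_ind: (d x) {-2}x (erefl (d x)) => n IH {}x dx xC.
  have [xc|xc] := boolP (x \in c); first by rewrite (fconnect_cycle fcyc xc).
  have [gC xg lt] := hg x xC xc; have fx : f x = g x by rewrite /f (negPf xc).
  by rewrite dx in lt; rewrite fconnect_eqVf fx (IH _ lt) ?orbT.
have fall u v : u \in C -> v \in C -> e u v -> v = f u \/ u = f v.
  move=> uC vC euv; have [->|vf] := eqVneq v (f u); first by left.
  have [->|uf] := eqVneq u (f v); first by right.
  have fe' x : x \in C -> f x = x \/ e x (f x) by move=> xC; right; apply: fe.
  have [c' cc'] := extra_edge_cycle fC fe' fz uC vC euv vf uf.
  rewrite (uniqc c' cc') => /imsetP [x xc /setP E].
  have fx : next c x = f x by rewrite /f (xc : x \in c).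
  have := E u; have := E v; rewrite !inE !eqxx orbT /= fx.
  move=> /esym/orP [/eqP vx|/eqP vx] /esym/orP [/eqP ux|/eqP ux].
  - by rewrite vx ux e_irr in euv.
  - by rewrite -vx in ux; right.
  - by rewrite -ux in vx; left.
  - by rewrite vx ux e_irr in euv.
have finv v : v \in C -> f (f v) != v.
  move=> vC; have [vc|vc] := boolP (v \in c).
    apply/eqP=> ffv; have := ordc v vc.
    have : order f v <= #|[set v; f v]|.
      apply: subset_leq_card; apply/subsetP => y; rewrite inE => /iter_findex <-.
      elim: (findex _ _ _) => [|k]; first by rewrite !inE eqxx.
      by rewrite iterS !inE => /orP [] /eqP ->; rewrite ?ffv eqxx ?orbT.
    rewrite cards2; case: (v != f v); lia.
  have [fvC _ lt] := hg v vC vc; have fv : f v = g v by rewrite /f (negPf vc).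
  have [fvc|fvc] := boolP (f v \in c).
    by apply: contraNneq vc => <-; apply: fcC.
  rewrite -fv in lt fvC; have [_ _] := hg _ fvC fvc.
  have -> : g (f v) = f (f v) by rewrite {2}/f (negPf fvc).
  by move=> lt'; apply/eqP=> E; rewrite E in lt'; lia.
have fun_f : functional_graph C f z by split.
have oddz : odd (order f z) by apply: contraR nbip; apply: functional_even_bipartite fun_f.
exists f, z; split=> //; last by exists c; rewrite // -(ordc z zc).
have szE c' : is_cycle e C c' -> size c' = size c.
  move=> cC'; have [sz' /andP [_ uc'] _] := and3P cC'.
  by rewrite -(card_cycle_edges uc' sz') (uniqc c' cC') card_cycle_edges.
rewrite ordc // in oddz *.
have [c' [cC' _ ]] := odd_girth_attained cC oddz.
rewrite /half_odd_girth (szE c' cC') => ->.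
by rewrite -[RHS]odd_double_half /= oddz.
Qed.

Lemma functional_nonleaf C f z v : functional_graph C f z -> v \in C ->
  (v \in f @: C) = (1 < degree e C v).
Proof.
move=> [zC fC fe fall finv fz] vC; rewrite /degree; apply/imsetP/idP => [[u uC vu]|].
  have -> : 1 = #|[set u]| by rewrite cards1.
  apply: proper_card; apply/properP; split.
    by rewrite sub1set inE uC vu e_sym fe.
  exists (f v); first by rewrite inE fC // fe.
  by rewrite inE vu finv.
move=> lt; have : ~~ ([set y in C | e v y] \subset [set f v]).
  by apply: contraTN lt => /subset_leq_card; rewrite cards1 -leqNgt.
case/subsetPn=> u; rewrite !inE => /andP [uC evu] ne; exists u => //.
by case: (fall v u vC uC evu) => // E; rewrite E eqxx in ne.
Qed.

(** The leaf edges are the edges {v, f v} for v outside the image of f. *)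
Lemma card_leaf_edges C f z : functional_graph C f z -> #|C| - #|leaf_edges e C| = #|f @: C|.
Proof.
move=> ff; have [zC fC fe fall finv fz] := ff.
have sub : f @: C \subset C by apply/subsetP => _ /imsetP [v vC ->]; apply: fC.
suff -> : #|leaf_edges e C| = #|C :\: f @: C|.
  by rewrite -(cardsID (f @: C) C) (setIidPr sub) addnK.
have deg1 v : v \in C -> (degree e C v == 1) = (v \notin f @: C).
  move=> vC; rewrite (functional_nonleaf ff vC).
  have : 0 < degree e C v by apply/card_gt0P; exists (f v); rewrite inE fC // fe.
  by case: (degree _ _ _) => [|[|n]].
have -> : leaf_edges e C = (fun v => [set v; f v]) @: (C :\: f @: C).
  apply/setP=> E; apply/idP/imsetP.
    rewrite inE => /andP [/imset2P [x y xC]]; rewrite inE => /andP [yC exy] ->.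
    case/existsP=> v; rewrite !inE => /andP [vxy].
    have vC : v \in C by case/orP: vxy => /eqP ->.
    rewrite deg1 // => vf; exists v; first by rewrite inE vf.
    case/orP: vxy => /eqP vE; rewrite vE in vf *.
      case: (fall x y xC yC exy) => [-> //|xE]; case/negP: vf; rewrite xE; exact: imset_f.
    rewrite setUC; case: (fall x y xC yC exy) => [yE|-> //]; case/negP: vf; rewrite yE;
      exact: imset_f.
  case=> v; rewrite inE => /andP [vf vC] ->; rewrite inE; apply/andP; split.
    by apply: imset2_f => //; rewrite inE fC // fe.
  by apply/existsP; exists v; rewrite !inE eqxx /= deg1.
rewrite card_in_imset // => u v; rewrite !inE => /andP [uf uC] /andP [vf vC] /setP E.
apply/eqP/negPn/negP=> ne; have := E u; rewrite !inE eqxx (negPf ne) /= => /esym/eqP ufv.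
by case/negP: uf; rewrite ufv imset_f.
Qed.

End FunctionalStructure.

(** * Fractional matchings and cuts *)

Section FractionalMatchings.
Variables (T : finType) (e : rel T).
Hypotheses (e_sym : ssrbool.symmetric e) (e_irr : irreflexive e).
Implicit Types (x y u v z : T) (S C W X Y : {set T}) (f : T -> T) (b : T -> nat) (mu : T -> T
  -> nat).

(** The matching is scaled by two: b v is the degree of v in mu / 2, which may be
half-integral. *)
Definition fractional_matching W b mu : Prop :=
  [/\ forall x y, mu x y = mu y x, forall x y, 0 < mu x y -> e x y
    & forall v, v \in W -> \sum_(u in W) mu v u = (b v).*2].

(** All of the weight at X goes to A, so the surplus of A over X is the weight of the
matching between A and the vertices outside X. *)
Lemma cut_identity W b mu (A X : {set T}) : fractional_matching W b mu ->
  A \subset W -> X \subset W -> nbrs e W X \subset A ->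
  (\sum_(v in A) b v).*2 = (\sum_(v in X) b v).*2 + \sum_(v in A) \sum_(u in W :\: X) mu v u.
Proof.
move=> [mu_sym mu_e mu_b] AW XW NA.
rewrite -!mul2n !big_distrr /=.
have -> : \sum_(v in A) 2 * b v = \sum_(v in A) \sum_(u in W) mu v u.
  by apply: eq_bigr => v vA; rewrite mul2n mu_b // (subsetP AW).
have -> : \sum_(v in X) 2 * b v = \sum_(v in A) \sum_(u in X) mu v u.
  rewrite exchange_big /=; apply: eq_bigr => u uX; rewrite mul2n -mu_b ?(subsetP XW) //.
  rewrite (big_setID A) /= (setIidPr AW) [X in _ + X]big1 ?addn0 => [|v].
    by apply: eq_bigr => v _; apply: mu_sym.
  rewrite inE => /andP [vA vW]; apply/eqP; rewrite -leqn0 leqNgt; apply: contra vA => /mu_e uv.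
  by apply: (subsetP NA); apply/nbrsP; split=> //; exists u.
rewrite -big_split; apply: eq_bigr => v vA /=.
by rewrite (big_setID X) /= (setIidPr XW).
Qed.

Lemma sum_leq_eq (P : {set T}) (F G : T -> nat) : (forall x, x \in P -> F x <= G x) ->
  \sum_(x in P) G x <= \sum_(x in P) F x -> forall x, x \in P -> F x = G x.
Proof.
move=> le tot x xP; apply/eqP; rewrite eqn_leq le //=; apply: contraLR tot;
  rewrite -!ltnNge => lt.
rewrite (bigD1 x) //= [in leqRHS](bigD1 x) //= -addSn; apply: leq_add => //.
by apply: leq_sum => y /andP [/le].
Qed.

(** By [expanding_cover] every cover has weight at least the total of b, so the
matching given by König's theorem on the double cover saturates all copies.
Identifying the two copies of each vertex doubles the degrees. *)
Lemma expanding_matching W b : expanding e b W -> exists mu, fractional_matching W b mu.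
Proof.
move=> hb; pose a v := if v \in W then b v else 0.
have suma (F : T -> nat) : \sum_x F x * a x = \sum_(x in W) F x * b x.
  by rewrite [RHS]big_mkcond; apply: eq_bigr => x _; rewrite /a; case: ifP; rewrite ?muln0.
have [w cw|mu [mu_e mu1 mu2 muN]] := b_matching (e := e) (a := a) (N := \sum_(v in W) b v) e_sym.
  by rewrite suma; apply: leq_trans (expanding_cover hb cw); apply: leq_addr.
have aW : \sum_(v in W) b v = \sum_(x in [set: T]) a x.
  have := suma (fun _ => 1); under eq_bigr do rewrite mul1n.
  under [in RHS]eq_bigr do rewrite mul1n.
  by move=> <-; apply: eq_bigl => x; rewrite inE.
have row x : \sum_y mu x y = a x.
  apply: (@sum_leq_eq setT (fun x => \sum_y mu x y) a _ _ x (in_setT x)) => [y _|];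
    first exact: mu1.
  by rewrite -aW; apply: leq_trans muN _; apply: eq_leq; apply: eq_bigl => y; rewrite inE.
have col y : \sum_x mu x y = a y.
  apply: (@sum_leq_eq setT (fun y => \sum_x mu x y) a _ _ y (in_setT y)) => [x _|];
    first exact: mu2.
  rewrite -aW; apply: leq_trans muN _; rewrite exchange_big /=.
  by apply: eq_leq; apply: eq_bigl => x; rewrite inE.
have out x y : x \notin W -> mu x y + mu y x = 0.
  move=> xW; have := row x; have := col x; rewrite /a (negPf xW) => /eqP.
  rewrite sum_nat_eq0 => /forallP /(_ y) /= /eqP -> /eqP.
  by rewrite sum_nat_eq0 => /forallP /(_ y) /= /eqP ->.
exists (fun x y => mu x y + mu y x); split.
- by move=> x y; rewrite addnC.
- move=> x y; rewrite addn_gt0 => /orP [/mu_e //|/mu_e]; by rewrite e_sym.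
- move=> v vW; transitivity (\sum_u (mu v u + mu u v)).
    rewrite big_mkcond; apply: eq_bigr => u _; case: ifP => // /negbT uW.
    by rewrite addnC out.
  by rewrite big_split /= row col /a vW addnn.
Qed.

(** For a vertex v let A v and X v be the vertices at even and at odd distance from v
along f.  The only edge from A v leaving X v is {v, f v}, met once if v is not on
the cycle and from both ends if it is.  Hence the cut identity computes mu v (f v)
from the weights of A v and X v.  If v is a nonleaf vertex then X v is nonempty and
the expansion makes mu v (f v) at least 2 or, on the cycle, at least 1.  On the
cycle A v and X v cover the component, so mu v (f v) has the parity of the total
of b. *)
Lemma component_lower_bound C f z b : closed_set e C -> functional_graph e C f z -> odd (order
  f z) ->
  expanding e b C ->
  (#|f @: C|).*2 <= \sum_(v in C) b v + odd (\sum_(v in C) b v) * order f z.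
Proof.
move=> clC ff oddz hb; have [zC fC fe fall finv fz] := ff.
have [mu fm] := expanding_matching hb; have [mu_sym mu_e mu_b] := fm.
have mu0 x y : ~~ e x y -> mu x y = 0.
  by move=> nxy; apply/eqP; rewrite -leqn0 leqNgt; apply: contra nxy => /mu_e.
have fid v : v \in C -> f v != v.
  by move=> vC; apply: contraTneq (fe v vC) => ->; rewrite e_irr.
pose Z := [set v | fconnect f z v].
have cycz : fconnect f (f z) z by apply/fz/fC.
have ZC : Z \subset C.
  apply/subsetP=> v; rewrite inE => /iter_findex <-.
  by elim: (findex _ _ _) => //= k; apply: fC.
have cardZ : #|Z| = order f z by rewrite cardsE.
have zZ v : v \in C -> (v \in Z) = fconnect f (f v) v.
  move=> vC; rewrite inE; apply/idP/idP => [zv | vv].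
    exact: connect_trans (fz _ (fC _ vC)) zv.
  rewrite fconnect_f in vv; rewrite (fconnect_cycle vv) ?in_orbit //.
  by rewrite -fconnect_orbit fz.
have lastZ v : v \in Z -> ~~ odd (findex f (f v) v).
  move=> vZ; have vC := subsetP ZC v vZ; have cyc := vZ; rewrite zZ // in cyc.
  have ozv : order f v = order f z.
    rewrite fconnect_f in cycz; rewrite inE in vZ.
    by rewrite (order_cycle cycz) ?size_orbit ?orbit_uniq -?fconnect_orbit.
  by rewrite findex_cycle // ozv; move: oddz; rewrite -(orderSpred f z) /=.
pose A v := [set u in C | fconnect f u v && ~~ odd (findex f u v)].
pose X v := [set u in C | fconnect f u v && odd (findex f u v)].
have AC v : A v \subset C by apply/subsetP=> u; rewrite inE => /andP [].
have XC v : X v \subset C by apply/subsetP=> u; rewrite inE => /andP [].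
have AX v u : u \in C -> fconnect f u v -> u != v -> (u \in A v) =
  (f u \in X v) /\ (u \in X v) = (f u \in A v).
  move=> uC uv ne; rewrite !inE uC fC //= uv (findexS uv ne) /=.
  have -> : fconnect f (f u) v by move: uv; rewrite fconnect_eqVf (negPf ne).
  by case: odd.
have XfA v u : u \in X v -> u != v /\ f u \in A v.
  move=> uX; move: (uX); rewrite inE => /and3P [uC uv od].
  have ne : u != v by apply: contraTneq od => ->; rewrite findex0.
  by split=> //; rewrite -(AX v u uC uv ne).2.
have XpA v u y : u \in X v -> y \in C -> f y = u -> y \in A v.
  move=> uX yC fy; move: (uX); rewrite inE => /and3P [uC uv od].
  have yv : fconnect f y v by rewrite fconnect_eqVf fy uv orbT.
  have ne : y != v.
    apply/eqP=> yE; have vZ : v \in Z by rewrite zZ -yE // fy yE.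
    by have := lastZ v vZ; rewrite -yE fy yE od.
  by rewrite (AX v y yC yv ne).1 fy.
have stX v : stable e (X v).
  move=> x y xX yX; apply/negP=> exy.
  have disj u : u \in X v -> u \in A v -> False.
    by rewrite !inE => /and3P [_ _ o] /and3P [_ _]; rewrite o.
  case: (fall x y (subsetP (XC v) _ xX) (subsetP (XC v) _ yX) exy) => E.
    by have [_] := XfA v x xX; rewrite -E; apply: disj.
  by have [_] := XfA v y yX; rewrite -E; apply: disj.
have NXA v : nbrs e C (X v) \subset A v.
  apply/subsetP=> y /nbrsP [yC [x xX exy]].
  case: (fall x y (subsetP (XC v) _ xX) yC exy) => E; last exact: XpA xX yC (esym E).
  by rewrite E; case: (XfA v x xX).
have vA v : v \in C -> v \in A v by move=> vC; rewrite inE vC connect0 findex0.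
have vX v : v \notin X v by rewrite inE findex0 /= !andbF.
have fvX v : v \in C -> f v \notin X v.
  move=> vC; rewrite inE; apply/negP=> /and3P [_ cyc od].
  by have := lastZ v; rewrite zZ // od => /(_ cyc).
have cut v : v \in C -> (\sum_(u in A v) b u).*2 =
    (\sum_(u in X v) b u).*2 + (mu v (f v) + (v \in Z) * mu v (f v)).
  move=> vC; rewrite (cut_identity fm (AC v) (XC v) (NXA v)); congr (_ + _).
  rewrite (bigD1 v) ?vA //=; congr (_ + _).
    rewrite (bigD1 (f v)) /=; last by rewrite inE fvX // fC.
    rewrite big1 ?addn0 // => y /andP []; rewrite inE => /andP [yX yC] yfv.
    apply: mu0; apply/negP=> /(fall v y vC yC) [E|E]; first by rewrite E eqxx in yfv.
    have yv : y != v by rewrite E eq_sym fid.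
    have ycv : fconnect f y v by rewrite E fconnect1.
    by case/negP: yX; rewrite (AX v y yC ycv yv).2 -E vA.
  have other u : u \in A v -> u != v -> \sum_(y in C :\: X v) mu u y = (f v == u) * mu u v.
    move=> uA uv; have := uA; rewrite inE => /and3P [uC ucv ev].
    rewrite (bigD1 v) /=; last by rewrite inE vX.
    rewrite big1 ?addn0 => [|y /andP []].
      have [_|ne] := eqVneq (f v) u; first by rewrite mul1n.
      rewrite mul0n; apply: mu0; apply/negP=> /(fall u v uC vC) [E|E].
        by have := (AX v u uC ucv uv).1; rewrite uA -E (negPf (vX v)).
      by rewrite E eqxx in ne.
    rewrite inE => /andP [yX yC] yv; apply: mu0; apply/negP=> /(fall u y uC yC) [E|E].
      by case/negP: yX; rewrite E -(AX v u uC ucv uv).1.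
    have ycv : fconnect f y v by rewrite fconnect_eqVf -E ucv orbT.
    by case/negP: yX; rewrite (AX v y yC ycv yv).2 -E.
  under eq_bigr => u /andP [uA uv] do rewrite other //.
  have [vZ|vZ] := boolP (v \in Z).
    have fvA : f v \in A v by rewrite inE fC // -zZ // vZ lastZ.
    rewrite (bigD1 (f v)) /= ?fvA ?fid // eqxx big1 ?addn0 ?mul1n; first exact: mu_sym.
    by move=> u /andP [_ ne]; rewrite eq_sym (negPf ne).
  rewrite big1 // => u /andP [uA _]; have [E|_] := eqVneq (f v) u; last by rewrite mul0n.
  by move: uA; rewrite -E inE -zZ // (negPf vZ) andbF.
have XX v : v \in f @: C -> \sum_(u in X v) b u < \sum_(u in A v) b u.
  case/imsetP=> u uC vE; apply: leq_trans (_ : \sum_(y in nbrs e C (X v)) b y <= _).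
    apply: hb => //.
    apply/set0Pn; exists u; have uv : u != v by rewrite vE eq_sym fid.
    have ucv : fconnect f u v by rewrite vE fconnect1.
    by rewrite (AX v u uC ucv uv).2 -vE vA // vE fC.
  by rewrite [in leqRHS](big_setID (nbrs e C (X v))) /= (setIidPr (NXA v)) leq_addr.
have low v : v \in f @: C -> 2 <= mu v (f v) + (v \in Z) * odd (\sum_(u in C) b u).
  move=> vf; have lt := XX v vf.
  have vC : v \in C by case/imsetP: vf => u uC ->; apply: fC.
  have := cut v vC; case: (boolP (v \in Z)) => vZ; rewrite ?mul0n ?mul1n; last by lia.
  have sumC : \sum_(u in C) b u = \sum_(u in A v) b u + \sum_(u in X v) b u.
    rewrite (big_setID (A v)) /= (setIidPr (AC v)); congr (_ + _); apply: eq_bigl => u.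
    rewrite !inE; case: (boolP (u \in C)) => uC //=.
    have -> : fconnect f u v by apply: connect_trans (fz u uC) _; rewrite inE in vZ.
    by rewrite negbK andbT.
  rewrite sumC => E.
  have -> : odd (\sum_(u in A v) b u + \sum_(u in X v) b u) = odd (mu v (f v)).
    have -> : \sum_(u in A v) b u = \sum_(u in X v) b u + mu v (f v) by lia.
    by rewrite addnAC oddD addnn odd_double.
  have : 0 < mu v (f v) by lia.
  by case: (mu v (f v)) => [|[|n]] // _; rewrite leq_addr.
(* Each edge {v, f v} is counted at both of its ends. *)
have total : \sum_(v in C) mu v (f v) = \sum_(v in C) b v.
  apply: double_inj.
  have -> : (\sum_(v in C) b v).*2 = \sum_(v in C) \sum_(u in C) mu v u.
    by rewrite -muln2 big_distrl; apply: eq_bigr => v vC; rewrite /= muln2 mu_b.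
  have split v u : v \in C -> u \in C -> mu v u =
    (u == f v) * mu v (f v) + (v == f u) * mu u (f u).
    move=> vC uC; have [E|ne] := eqVneq u (f v).
      rewrite mul1n -E; have [E'|_] := eqVneq v (f u); last by rewrite mul0n addn0.
      by have := finv v vC; rewrite -E -E' eqxx.
    have [E|ne'] := eqVneq v (f u); first by rewrite mul0n mul1n -E mu_sym.
    rewrite !mul0n; apply: mu0; apply/negP=> /(fall v u vC uC) [E|E].
      by rewrite E eqxx in ne.
    by rewrite E eqxx in ne'.
  have one v : v \in C -> \sum_(u in C) (u == f v) * mu v (f v) = mu v (f v).
    move=> vC; rewrite (bigD1 (f v)) ?fC //= eqxx mul1n big1 ?addn0 // => u /andP [_ /negPf ->].
    by rewrite mul0n.
  rewrite [RHS](eq_bigr (fun v => \sum_(u in C) (u == f v) * mu v (f v) + \sum_(u in C) (v == f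
    u) * mu u (f u))) => [|v vC].
    rewrite [RHS]big_split /= [X in _ = _ + X]exchange_big /= -addnn.
    by congr (_ + _); apply: eq_bigr => v vC; rewrite one.
  by rewrite -big_split; apply: eq_bigr => u uC; apply: split.
have fCC : f @: C \subset C by apply/subsetP => _ /imsetP [u uC ->]; apply: fC.
rewrite -cardZ -sum1_card -muln2 big_distrl /=.
apply: leq_trans (_ : \sum_(v in f @: C) (mu v (f v) + (v \in Z) * odd (\sum_(u in C) b u)) <= _).
  by apply: leq_sum => v vf; rewrite mul1n; apply: low.
rewrite big_split; apply: leq_add.
  by rewrite -total [in leqRHS](big_setID (f @: C)) /= (setIidPr fCC) leq_addr.
rewrite -big_distrl /= mulnC leq_mul2l; apply/orP; right.
rewrite -sum1_card [leqRHS]big_mkcond /= big_mkcond /=; apply: leq_sum => v _.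
by case: (v \in Z); case: ifP.
Qed.

End FractionalMatchings.

(** * Lower bound for odd expanding weights *)

Local Arguments half_odd_girth : simpl never.

Lemma functional_order_le (T : finType) (e : rel T) (C : {set T}) f z :
  functional_graph e C f z -> order f z <= #|f @: C|.
Proof.
move=> [zC fC fe fall finv fz]; apply: subset_leq_card; apply/subsetP => v.
rewrite inE => /iter_findex <-.
have iC k : iter k f z \in C by elim: k => //= k; apply: fC.
case: (findex f z v) => [|k]; last by rewrite iterS imset_f.
have /= <- : iter (order f z) f z = z by apply: (all_iffLR orbitPcycle 2 4); apply/fz/fC.
by rewrite -orderSpred iterS imset_f.
Qed.

Lemma odd_sum_odd (I : finType) (P : {set I}) (F : I -> nat) : (forall i, i \in P -> odd (F i)) ->
  odd (\sum_(i in P) F i) = odd #|P|.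
Proof.
move=> h; rewrite -sum1_card !(big_morph odd oddD (erefl _)).
by apply: eq_bigr => i /h ->.
Qed.


Section LowerBound.
Variables (T : finType) (e : rel T).
Hypotheses (e_sym : ssrbool.symmetric e) (e_irr : irreflexive e) (e_pf : pseudoforest e).
Implicit Types (C S W : {set T}) (P : {set {set T}}) (b : T -> nat).

Lemma nonbip_components_cover P : P \subset components e setT ->
  nonbip_components e (cover P) = [set C in P | ~~ bipartite e C].
Proof. by move=> sP; rewrite /nonbip_components components_cover. Qed.

(** The summand [~~ odd _ * _] is the extra cost of an even total. *)
Lemma component_weight C b : C \in components e setT -> ~~ bipartite e C -> expanding e b C ->
  ((#|C| - #|leaf_edges e C| - half_odd_girth e C).*2 + 1 +
   ~~ odd (\sum_(v in C) b v) * (half_odd_girth e C).*2.-1 <= \sum_(v in C) b v).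
Proof.
move=> Cc nb hb; have [f [z [ff oz kE _]]] := nonbipartite_functional e_sym e_irr Cc nb (e_pf Cc).
have := component_lower_bound e_sym e_irr (component_closed Cc) ff oz hb.
rewrite (card_leaf_edges e_sym ff); have := functional_order_le ff.
move: (half_odd_girth e C) kE => k kE.
by case: odd => /=; rewrite ?mul1n ?mul0n; lia.
Qed.

Lemma expanding_component P C b : P \subset components e setT -> C \in P ->
  expanding e b (cover P) -> expanding e b C.
Proof.
move=> sP CP hb Y YC Y0 stY; have CW := component_sub_cover CP.
have -> : nbrs e C Y = nbrs e (cover P) Y; last by apply: hb => //; apply: subset_trans CW.
apply/setP=> v; apply/nbrsP/nbrsP=> [[vC hx]|[vW [x xY xv]]]; first by rewrite (subsetP CW).
split; last by exists x.
by apply: (component_closed (subsetP sP C CP)) xv; apply: (subsetP YC).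
Qed.

Lemma half_odd_girth_sub C S : C \in components e setT -> ~~ bipartite e C -> C \subset S ->
  half_odd_girth e S <= half_odd_girth e C.
Proof.
move=> Cc nb CS; have [f [z [_ _ _ [c cC oc]]]] :=
  nonbipartite_functional e_sym e_irr Cc nb (e_pf Cc).
by apply: half_leq; rewrite ltnS; apply: odd_girth_sub CS cC oc.
Qed.

(** The totals of b on the components add up to an odd number, so for an even number
of components at least one total is even and pays the extra cost. *)
Lemma n0_lower_bound P m : P \subset components e setT ->
  critical_size e m (cover [set C in P | ~~ bipartite e C]) ->
  [set C in P | ~~ bipartite e C] != set0 -> n0 e (cover P) <= m.
Proof.
move=> sP hW P0; rewrite /n0 nonbip_components_cover //; set Q := [set C in P | _] in hW P0 *.
have QP : Q \subset P by apply/subsetP=> C; rewrite inE => /andP [].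
have sQ := subset_trans QP sP.
have Qc C : C \in Q -> C \in components e setT by apply: (subsetP sQ).
have Qn C : C \in Q -> ~~ bipartite e C by rewrite inE => /andP [].
case: hW => [W0|[b hb bm]].
  have [C CQ] := set0Pn _ P0; have /componentsP [x Cx] := Qc C CQ.
  have := subsetP (component_sub_cover CQ) x; rewrite W0 inE {1}Cx component_of_refl.
  by move/(_ isT).
have w C (CQ : C \in Q) := component_weight (Qc C CQ) (Qn C CQ) (expanding_component sQ CQ hb).
set sigma := \sum_(C in Q) _; pose beta C := \sum_(v in C) b v.
have sumb : \sum_(C in Q) beta C = \sum_(v in cover Q) b v by rewrite (sum_cover e_sym).
have tot : sigma.*2 + #|Q| <= \sum_(C in Q) beta C.
  rewrite -muln2 big_distrl -sum1_card -big_split; apply: leq_sum => C /w /=.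
  by rewrite -/(beta C) muln2; apply: leq_trans; apply: leq_addr.
rewrite cards_eq0 (negPf P0); case: ifP => s_odd.
  have := odd_double_half #|Q|; rewrite s_odd; move: tot; rewrite sumb.
  by move: bm; move: (#|Q|) (#|Q|./2) (\sum_(v in cover Q) b v) sigma => q h B sg; lia.
have [C0 C0Q ev] : exists2 C, C \in Q & ~~ odd (beta C).
  have /existsP [C /andP [CQ ev]] : [exists C in Q, ~~ odd (beta C)]; last by exists C.
  rewrite -[X in is_true X]negbK negb_exists; apply/negP=> /forallP h.
  have : odd (\sum_(C in Q) beta C) = odd #|Q|.
    by apply: odd_sum_odd => C CQ; have := h C; rewrite CQ negbK.
  rewrite s_odd sumb; have := odd_double m; rewrite -bm /=; by case: odd.
have tot' : sigma.*2 + #|Q| + (half_odd_girth e C0).*2.-1 <= \sum_(C in Q) beta C.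
  rewrite /sigma (bigD1 C0) //= [in leqRHS](bigD1 C0) //=.
  have -> : #|Q| = 1 + \sum_(C in Q | C != C0) 1 by rewrite -sum1_card (bigD1 C0).
  have h1 := w C0 C0Q; rewrite -/(beta C0) ev mul1n in h1.
  have h2 : (\sum_(C in Q | C != C0) (#|C| - #|leaf_edges e C| - half_odd_girth e C)).*2 +
     \sum_(C in Q | C != C0) 1 <= \sum_(C in Q | C != C0) beta C.
    rewrite -muln2 big_distrl -big_split; apply: leq_sum => C /andP [/w + _] /=.
    by rewrite -/(beta C) muln2; apply: leq_trans; apply: leq_addr.
  rewrite doubleD; apply: leq_trans (leq_add h1 h2).
  by rewrite -!addnA leq_add2l; set sg := (\sum_(C in Q | _) _).*2; lia.
have C0P : C0 \subset cover P by apply: component_sub_cover; apply: (subsetP QP).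
have := half_odd_girth_sub (Qc C0 C0Q) (Qn C0 C0Q) C0P.
clear tot; have := odd_double_half #|Q|; rewrite s_odd; move: tot'; rewrite sumb.
move: (half_odd_girth e C0) (half_odd_girth e (cover P)) => k0 k.
by move: bm; move: (#|Q|) (#|Q|./2) (\sum_(v in cover Q) b v) sigma => q h B sg; lia.
Qed.

End LowerBound.

(** * Half-integral expanding weights *)

Section HalfIntegral.
Variables (T : finType) (e : rel T).
Hypotheses (e_sym : ssrbool.symmetric e) (e_irr : irreflexive e).
Implicit Types (x y u v z : T) (C W X Y Z : {set T}) (b : T -> nat) (f : T -> T).

(** Each of two sets containing the other's neighbours would have to outweigh the
other. *)
Lemma expanding_not_bipartite W b X Y : expanding e b W -> X \subset W -> Y \subset W ->
  stable e X -> stable e Y -> nbrs e W X \subset Y -> nbrs e W Y \subset X ->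
  X = set0 /\ Y = set0.
Proof.
move=> hb.
have step X' Y' : X' \subset W -> stable e X' -> nbrs e W X' \subset Y' -> X' != set0 ->
    \sum_(v in X') b v < \sum_(v in Y') b v.
  move=> XW stX NX X0; apply: leq_trans (hb X' XW X0 stX) _.
  by rewrite [in leqRHS](big_setID (nbrs e W X')) /= (setIidPr NX) leq_addr.
have half X' Y' : X' \subset W -> Y' \subset W -> stable e X' -> stable e Y' ->
    nbrs e W X' \subset Y' -> nbrs e W Y' \subset X' -> X' = set0.
  move=> XW YW stX stY NX NY; apply/eqP/negPn/negP=> X0.
  have lt := step _ _ XW stX NX X0.
  have Y0 : Y' != set0 by apply: contraTneq lt => ->; rewrite big_set0.
  by have := step _ _ YW stY NY Y0; rewrite ltnNge ltnW.
by move=> XW YW stX stY NX NY; split; [apply: (half X Y) | apply: (half Y X)].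
Qed.

Definition inner W : {set T} := [set v in W | 1 < #|nbrs e W [set v]|].

Lemma nbrs1 W v u : (u \in nbrs e W [set v]) = (u \in W) && e v u.
Proof.
apply/nbrsP/andP=> [[uW [x]]|[uW vu]]; first by rewrite inE => /eqP ->.
by split=> //; exists v; rewrite ?inE.
Qed.

Lemma innerP W v x y : v \in W -> x \in W -> y \in W -> e v x -> e v y -> x != y -> v \in inner W.
Proof.
move=> vW xW yW vx vy ne; rewrite inE vW; apply: leq_trans (_ : #|[set x; y]| <= _).
  by rewrite cards2 ne.
apply: subset_leq_card; apply/subsetP=> u; rewrite !inE -/(nbrs _ _ _).
by case/orP=> /eqP ->; [move: xW|move: yW] => ->; apply/existsP; exists v; rewrite inE eqxx.
Qed.

(** If all edges from the neighbourhood Y of X to vertices outside X ended in leaves,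
then Y would contain the neighbours of X and these leaves, and conversely, contradicting
[expanding_not_bipartite]. *)
Lemma inner_edge_leaving W b X : expanding e b W -> X \subset W -> X != set0 -> stable e X ->
  exists v u, [/\ v \in nbrs e W X, u \in W :\: X, e v u, v \in inner W & u \in inner W].
Proof.
move=> hb XW X0 stX; set Y := nbrs e W X.
have [/existsP [v /existsP [u /and5P [? ? ? ? ?]]]|no] :=
  boolP [exists v, [exists u, [&& v \in Y, u \in W :\: X, e v u, v \in inner W & u \in inner W]]].
  by exists v, u.
have {}no v u : v \in Y -> u \in W -> u \notin X -> e v u -> u \notin inner W.
  move=> vY uW uX vu; apply/negP=> ui; case/negP: no; apply/existsP; exists v.
  apply/existsP; exists u; rewrite vY vu ui andbT inE uX uW /=.
  case/nbrsP: vY => vW [x xX xv]; apply: (@innerP W v x u) => //; first exact: (subsetP XW).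
    by rewrite e_sym.
  by apply: contraNneq uX => <-.
(* Each vertex of L has its only neighbour in Y. *)
pose L := [set u in W :\: X | [exists v in Y, e v u]].
have LP u : u \in L -> [/\ u \in W, u \notin X & exists2 v, v \in Y & forall y, y \in W -> e u
  y -> y = v].
  rewrite inE => /andP [] /[!inE] /andP [uX uW] /existsP [v /andP [vY vu]]; split=> //.
  exists v => // y yW uy; apply/eqP/negPn/negP=> ne; case/negP: (no v u vY uW uX vu).
  by apply: (@innerP W u y v) => //; [case/nbrsP: vY | rewrite e_sym].
have YX v : v \in Y -> v \notin X.
  by case/nbrsP=> vW [x xX xv]; apply/negP=> vX; have := stX _ _ xX vX; rewrite xv.
have YW : Y \subset W by apply/subsetP=> v /nbrsP [].
have YL v : v \in Y -> v \notin L.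
  move=> vY; apply/negP=> /LP [vW vX [v' v'Y only]]; case/nbrsP: (vY) => _ [x xX xv].
  have xv' := only x (subsetP XW _ xX); rewrite e_sym in xv'.
  by have := YX v' v'Y; rewrite -xv' // xX.
have nbX x y : x \in X -> y \in W -> e x y -> y \in Y.
  by move=> xX yW xy; apply/nbrsP; split=> //; exists x.
have stXL : stable e (X :|: L).
  have half x y : x \in X -> y \in X :|: L -> ~~ e x y.
    rewrite inE => xX /orP [yX|yL]; first exact: stX.
    apply/negP=> xy; have [yW _ _] := LP y yL.
    by have := YL y (nbX x y xX yW xy); rewrite yL.
  move=> x y; rewrite inE => /orP [xX yXL|xL]; first exact: half.
  rewrite inE => /orP [yX|yL]; first by rewrite e_sym half // inE xL orbT.
  apply/negP=> xy; have [_ _ [v vY only]] := LP x xL; have [yW _ _] := LP y yL.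
  by have := YL v vY; rewrite -(only y yW xy) yL.
have stY : stable e Y.
  move=> u v uY vY; apply/negP=> uv; have := YL v vY; case/negP.
  by rewrite !inE YX // (subsetP YW) //=; apply/existsP; exists u; rewrite uY.
have XLW : X :|: L \subset W.
  by rewrite subUset XW /=; apply/subsetP=> u /LP [].
have NXL : nbrs e W (X :|: L) \subset Y.
  apply/subsetP=> y /nbrsP [yW [x]]; rewrite inE => /orP [xX|xL] xy; first exact: nbX xy.
  by have [_ _ [v vY only]] := LP x xL; rewrite (only y yW xy).
have NY : nbrs e W Y \subset X :|: L.
  apply/subsetP=> u /nbrsP [uW [v vY vu]]; rewrite inE; case: (boolP (u \in X)) => //= uX.
  by rewrite !inE uX uW; apply/existsP; exists v; rewrite vY.
have [XL0 _] := expanding_not_bipartite hb XLW YW stXL stY NXL NY.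
by case/negP: X0; rewrite -subset0 -XL0 subsetUl.
Qed.

Definition inner_degree W v : nat := (v \in inner W) * #|[set u in inner W | e v u]|.

(** The weight b is the degree vector of the fractional matching with value 1 on the
edges between nonleaf vertices, lowered to 1/2 on the edges {v, f v} with v in Z;
each vertex of Z lies on exactly two of these.  It is positive on all edges between
nonleaf vertices, so [inner_edge_leaving] and the cut identity give the expansion. *)
Lemma half_integral_expanding W Z b0 f : expanding e b0 W -> Z \subset W ->
  (forall v, v \in Z -> [/\ f v \in Z, e v (f v) & f (f v) != v]) -> {in Z &, injective f} ->
  exists2 b, expanding e b W & \sum_(v in W) b v + #|Z| = \sum_(v in W) inner_degree W v.
Proof.
move=> hb0 ZW hZ injf.
have fZ : f @: Z = Z.
  apply/eqP; rewrite eqEcard card_in_imset // leqnn andbT.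
  by apply/subsetP=> _ /imsetP [v vZ ->]; case: (hZ v vZ).
have Zin v : v \in Z -> v \in inner W.
  move=> vZ; have [fvZ vfv _] := hZ v vZ; move: (vZ); rewrite -fZ => /imsetP [u uZ E].
  have [_ ufu ffu] := hZ u uZ.
  apply: (@innerP W v (f v) u); rewrite ?(subsetP ZW) //; first by rewrite e_sym E.
  by rewrite E.
have WI : inner W \subset W by apply/subsetP=> v; rewrite inE => /andP [].
pose nl v u := [&& v \in inner W, u \in inner W & e v u].
(* The edges on which the matching is lowered, directed by f. *)
pose ev v u := (v \in Z) && (u == f v).
pose mu v u := (nl v u).*2 - (ev v u + ev u v).
have ev_nl v u : ev v u -> nl v u.
  move=> /andP [vZ /eqP ->]; have [fvZ vfv _] := hZ v vZ; by rewrite /nl !Zin.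
have nl_sym v u : nl v u = nl u v by rewrite /nl e_sym; case: (v \in _); case: (u \in _).
have ev_excl v u : ev v u -> ~~ ev u v.
  move=> /andP [vZ /eqP ->]; have [_ _ ffv] := hZ v vZ.
  by rewrite /ev negb_and eq_sym ffv orbT.
have muE v u : mu v u + (ev v u + ev u v) = (nl v u).*2.
  rewrite /mu; have := @ev_excl v u; have := @ev_nl v u; have := @ev_nl u v; rewrite (nl_sym u v).
  case: (nl v u); case: (ev v u); case: (ev u v) => //= h1 h2 h3;
    by first [have := h1 isT | have := h2 isT | have := h3 isT].
have mu_gt0 v u : nl v u -> 0 < mu v u.
  move=> n; have := muE v u; rewrite n.
  case: (ev v u) (@ev_excl v u) => [/(_ isT)/negPf -> /=|_]; first by lia.
  by case: (ev u v) => /=; lia.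
have evW v : v \in W -> \sum_(u in W) ev v u = (v \in Z).
  move=> vW; case: (boolP (v \in Z)) => vZ; last first.
    by rewrite big1 // => u _; rewrite /ev (negPf vZ).
  have fvW : f v \in W by apply: (subsetP ZW); case: (hZ v vZ).
  by rewrite (bigD1 (f v)) //= /ev vZ eqxx big1 // => u /andP [_ /negPf ->].
have evW' v : v \in W -> \sum_(u in W) ev u v = (v \in Z).
  move=> vW; case: (boolP (v \in Z)) => vZ; last first.
    rewrite big1 // => u _; rewrite /ev; case: (boolP (u \in Z)) => //= uZ.
    by case: eqP => // E; case/negP: vZ; rewrite E; case: (hZ u uZ).
  move: (vZ); rewrite -{1}fZ => /imsetP [u uZ E].
  rewrite (bigD1 u) ?(subsetP ZW) //= /ev uZ E eqxx big1 // => y /andP [yW ne].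
  apply/eqP; rewrite eqb0; apply/negP=> /andP [yZ /eqP fuy].
  by case/negP: ne; rewrite (injf _ _ uZ yZ fuy).
have nlW v : v \in W -> \sum_(u in W) nl v u = inner_degree W v.
  move=> vW; rewrite /inner_degree /nl; case: (boolP (v \in inner W)) => vi; last first.
    by rewrite big1 // mul0n.
  rewrite mul1n -sum1_card big_mkcond [RHS]big_mkcond; apply: eq_bigr => u _.
  rewrite inE; case: (boolP (u \in inner W)) => ui; last by case: (u \in W).
  by rewrite (subsetP WI) //=; case: (e v u).
have degE v : v \in W -> \sum_(u in W) mu v u + (v \in Z).*2 = (inner_degree W v).*2.
  move=> vW; rewrite -nlW // -!addnn -{1}(evW v vW) -(evW' v vW) -!big_split /=.
  by apply: eq_bigr => u _; rewrite muE addnn.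
pose b v := inner_degree W v - (v \in Z).
have bE v : v \in W -> \sum_(u in W) mu v u = (b v).*2.
  by move=> vW; have := degE v vW; rewrite /b; lia.
exists b; last first.
  rewrite -sum1_card big_mkcond [X in _ + X]big_mkcond [RHS]big_mkcond -big_split /=.
  apply: eq_bigr => v _; case: (boolP (v \in W)) => vW; last first.
    by rewrite ifN //; apply: contra vW; apply: (subsetP ZW).
  by have := degE v vW; rewrite /b; case: (v \in Z) => /=; lia.
have fm : fractional_matching e W b mu.
  split=> // [v u|v u]; first by rewrite /mu nl_sym addnC.
  by rewrite /mu; case: (boolP (nl v u)) => // /and3P [].
move=> X XW X0 stX; have [v [u [vN uX vu vi ui]]] := inner_edge_leaving hb0 XW X0 stX.
have NW : nbrs e W X \subset W by apply/subsetP=> y /nbrsP [].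
have := cut_identity fm NW XW (subxx _).
have : mu v u <= \sum_(y in nbrs e W X) \sum_(x in W :\: X) mu y x.
  by rewrite (bigD1 v) //= (bigD1 u) //= -addnA leq_addr.
have : 0 < mu v u by apply: mu_gt0; rewrite /nl vi ui.
lia.
Qed.

End HalfIntegral.

(** * Upper bound by the invariant of a union of components *)

Section UpperBound.
Variables (T : finType) (e : rel T).
Hypotheses (e_sym : ssrbool.symmetric e) (e_irr : irreflexive e) (e_pf : pseudoforest e).
Implicit Types (x y u v z : T) (C W X Y Z : {set T}) (b : T -> nat) (f : T -> T) (P S : {set
  {set T}}).

(** Each of the two colour classes inside C contains the neighbours of the other. *)
Lemma expanding_two_coloring W b C (A : {set T}) x : expanding e b W -> closed_set e C ->
  (forall u v, u \in W -> v \in W -> u \in C -> v \in C -> e u v ->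
     (u \in A) != (v \in A)) ->
  x \in W -> x \notin C.
Proof.
move=> hb clC bip xW; apply/negP=> xC.
have [||||||X0 Y0] := @expanding_not_bipartite T e W b (W :&: C :&: A) ((W :&: C) :\: A) hb.
- by rewrite -setIA subsetIl.
- by apply: subset_trans (subsetDl _ _) (subsetIl _ _).
- move=> u y; rewrite !in_setI => /andP [/andP [uW uC] uA] /andP [/andP [yW yC] yA].
  by apply/negP=> /(bip u y uW yW uC yC); rewrite uA yA.
- move=> u y; rewrite !in_setD !in_setI => /andP [uA /andP [uW uC]] /andP [yA /andP [yW yC]].
  by apply/negP=> /(bip u y uW yW uC yC); rewrite (negPf uA) (negPf yA).
- apply/subsetP=> y /nbrsP [yW [u]]; rewrite in_setD !in_setI => /andP [/andP [uW uC] uA] uy.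
  have yC := clC _ _ uC uy; rewrite yW yC andbT.
  by have := bip u y uW yW uC yC uy; rewrite uA; case: (y \in A).
- apply/subsetP=> y /nbrsP [yW [u]]; rewrite in_setD !in_setI => /andP [uA /andP [uW uC]] uy.
  have yC := clC _ _ uC uy; rewrite yW yC.
  by have := bip u y uW yW uC yC uy; rewrite (negPf uA); case: (y \in A).
have : x \in (W :&: C :&: A) :|: ((W :&: C) :\: A).
  by rewrite in_setU in_setD !in_setI xW xC; case: (x \in A).
by rewrite X0 Y0 !inE.
Qed.

Lemma expanding_meets_nonbipartite W b C x : expanding e b W -> C \in components e setT ->
  x \in W -> x \in C -> ~~ bipartite e C.
Proof.
move=> hb Cc xW xC; apply/negP=> /existsP [A /forallP hA].
have /negP [//] : x \notin C.
apply: (@expanding_two_coloring W b C A) => // [|u v _ _ uC vC uv];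
  first exact: component_closed Cc.
by have /implyP/(_ uC)/forallP/(_ v)/implyP/(_ vC)/implyP := hA u; apply.
Qed.

(** If W misses a vertex v of the cycle, then the parity of the distance to v colours
the rest of W. *)
Lemma expanding_meets_cycle W b C x f z v : expanding e b W -> C \in components e setT ->
  functional_graph e C f z -> x \in W -> x \in C -> fconnect f z v -> v \in W.
Proof.
move=> hb Cc ff xW xC zv; apply/negPn/negP=> vW; have [zC fC fe fall finv fz] := ff.
have conn u : u \in C -> fconnect f u v by move=> /fz uz; apply: connect_trans uz zv.
have nv u : u \in W -> u != v by move=> uW; apply: contraNneq vW => <-.
have /negP [//] : x \notin C.
apply: (@expanding_two_coloring W b C [set u | odd (findex f u v)]) => //.
  exact: component_closed Cc.
by move=> u y uW yW uC yC uy; apply: (odd_findex_bipartite fall conn) => //; apply: nv.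
Qed.

(** [half_integral_expanding] is applied to the cycles of the components in S.  An edge
{v, f v} between nonleaf vertices of W is determined by v, which is a nonleaf vertex
of its component as well, so there are at most as many of them as such vertices. *)
Lemma half_integral_weight W b0 S (P := component_of e @: W) :
  expanding e b0 W -> S \subset P ->
  exists b q, [/\ expanding e b W, q <= \sum_(C in P) (#|C| - #|leaf_edges e C|)
    & \sum_(v in W) b v + \sum_(C in S) (half_odd_girth e C).*2.-1 = q.*2].
Proof.
move=> hb0 SP.
have Pc C : C \in P -> C \in components e setT.
  by case/imsetP=> x _ ->; apply/componentsP; exists x.
have Pn C : C \in P -> ~~ bipartite e C.
  move=> CP; case/imsetP: (CP) => x xW Cx.
  by apply: (expanding_meets_nonbipartite hb0 (Pc C CP) xW); rewrite Cx component_of_refl.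
have compP v : v \in W -> component_of e v \in P by apply: imset_f.
have ex C : exists fZ : (T -> T) * {set T}, C \in P -> exists z,
    [/\ functional_graph e C fZ.1 z, fZ.2 = [set v | fconnect fZ.1 z v]
      & #|fZ.2| = (half_odd_girth e C).*2.-1].
  case: (boolP (C \in P)) => CP; last by exists (id, set0).
  have [f [z [ff oz kE _]]] := nonbipartite_functional e_sym e_irr (Pc C CP) (Pn C CP) (e_pf
    (Pc C CP)).
  by exists (f, [set v | fconnect f z v]) => _; exists z; rewrite kE cardsE.
have [F hF] := fin_all_exists ex.
pose c := component_of e; pose f v := (F (c v)).1 v.
have inC v C : C \in P -> v \in C -> c v = C by move=> CP vC;
  rewrite /c -(component_eq e_sym (Pc C CP) vC).
have cv v : v \in c v by apply: component_of_refl.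
pose Z := [set v in W | (c v \in S) && (v \in (F (c v)).2)].
have ZW : Z \subset W by apply/subsetP=> v; rewrite inE => /andP [].
have cycW C v : C \in P -> v \in (F C).2 -> v \in W /\ v \in C.
  move=> CP; have [z [ff -> _]] := hF C CP; rewrite inE => zv.
  case/imsetP: (CP) => x xW Cx; have xC : x \in C by rewrite Cx component_of_refl.
  split; first exact: (expanding_meets_cycle hb0 (Pc C CP) ff xW xC zv).
  rewrite -(iter_findex zv); elim: (findex _ _ _) => [|k IHk]; first exact: (functional_root ff).
  by rewrite iterS; apply: (functional_closed ff).
have fc v : c v \in P -> c (f v) = c v.
  by move=> CP; have [z [ff _ _]] := hF _ CP; apply: inC => //;
    apply: (functional_closed ff (cv v)).
have hZ v : v \in Z -> [/\ f v \in Z, e v (f v) & f (f v) != v].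
  rewrite inE => /and3P [vW cS vF]; have CP := subsetP SP _ cS.
  have [z [ff FE _]] := hF _ CP; have fvF : f v \in (F (c v)).2.
    move: vF; rewrite FE !inE => zv; exact: connect_trans zv (fconnect1 _ _).
  split.
  - by rewrite inE fc // cS fvF; case: (cycW _ _ CP fvF) => ->.
  - exact: (functional_edge ff (cv v)).
  - by rewrite {1}/f fc //; apply: (functional_no2cycle ff (cv v)).
have injf : {in Z &, injective f}.
  move=> u v; rewrite !inE => /and3P [uW cuS uF] /and3P [vW cvS vF] fuv.
  have CP := subsetP SP _ cuS.
  have cuv : c u = c v by rewrite -(fc u) ?fuv ?fc // (subsetP SP).
  have [z [ff FE _]] := hF _ CP; move: fuv; rewrite /f -cuv.
  have cyc : fconnect (F (c u)).1 ((F (c u)).1 z) z by apply/(functional_conn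
    ff)/(functional_closed ff)/(functional_root ff).
  apply: (all_iffLR orbitPcycle 2 5 cyc); rewrite -fconnect_orbit.
    by move: uF; rewrite FE inE.
  by move: vF; rewrite -cuv FE inE.
have [b hb bZ] := half_integral_expanding e_sym hb0 ZW hZ injf.
have WI v : v \in inner e W -> v \in W by rewrite inE => /andP [].
(* The number of edges between nonleaf vertices of W. *)
pose q := #|[set v in inner e W | f v \in inner e W]|.
exists b, q; split=> //.
- have le : q <= #|inner e W|.
    by apply: subset_leq_card; apply/subsetP=> v; rewrite inE => /andP [].
  apply: leq_trans le _; rewrite -sum1_card (partition_big c (mem P)) => [|v /WI vW];
    last exact: compP.
  apply: leq_sum => C CP; have [z [ff _ _]] := hF C CP;
    rewrite (card_leaf_edges e_sym ff) -sum1_card.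
  rewrite big_mkcond [leqRHS]big_mkcond; apply: leq_sum => v _.
  case: ifP => // /andP [vi /eqP vC]; rewrite ifT //.
  have vCC : v \in C by rewrite -vC.
  rewrite (functional_nonleaf e_sym ff vCC); move: vi; rewrite inE => /andP [vW lt].
  apply: leq_trans lt _; apply: subset_leq_card; apply/subsetP=> u;
    rewrite nbrs1 inE => /andP [uW vu].
  by rewrite vu (component_closed (Pc C CP) vCC vu).
have cardZ : #|Z| = \sum_(C in S) (half_odd_girth e C).*2.-1.
  rewrite -sum1_card (partition_big c (mem S)) => [|v]; last by rewrite inE => /and3P [].
  apply: eq_bigr => C CS; have CP := subsetP SP _ CS; have [z [ff FE <-]] := hF C CP.
  rewrite -sum1_card; apply: eq_bigl => v; rewrite inE; apply/andP/idP.
    by case=> /and3P [_ _ vF] /eqP <-.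
  move=> vF; have [vW vC] := cycW C v CP vF.
  by rewrite (inC v C CP vC) vW vF (CS : C \in S) eqxx.
rewrite -cardZ bZ.
have -> : \sum_(v in W) inner_degree e W v =
    \sum_(v in inner e W) \sum_(u in inner e W) ((u == f v) + (v == f u)).
  rewrite big_mkcond [RHS]big_mkcond; apply: eq_bigr => v _; rewrite /inner_degree.
  case: (boolP (v \in inner e W)) => vi; last by rewrite mul0n if_same.
  rewrite WI // mul1n -sum1_card big_mkcond [RHS]big_mkcond; apply: eq_bigr => u _; rewrite inE.
  case: (boolP (u \in inner e W)) => //= ui; have [vW uW] := (WI v vi, WI u ui).
  have CPv := compP v vW; have CPu := compP u uW.
  have [z [ff _ _]] := hF _ CPv; have [z' [ff' _ _]] := hF _ CPu.
  have [E|ne] := eqVneq u (f v).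
    have -> : e v u by rewrite E; apply: (functional_edge ff (cv v)).
    have [E'|//] := eqVneq v (f u); have := functional_no2cycle ff (cv v).
    by rewrite -/(f v) -E; move: E'; rewrite /f E fc // => <-; rewrite eqxx.
  have [E|ne'] := eqVneq v (f u).
    by have -> : e v u by rewrite e_sym E; apply: (functional_edge ff' (cv u)).
  case: (boolP (e v u)) => // vu.
  have uC : u \in c v by apply: (component_closed (Pc _ CPv)) vu.
  have cuv : c u = c v by apply: inC.
  case: (functional_edges ff (cv v) uC vu) => E; first by rewrite /f -E eqxx in ne.
  by rewrite /f cuv -E eqxx in ne'.
have row (G : T -> bool) : \sum_(v in inner e W | G v) 1 = #|[set v in inner e W | G v]|.
  by rewrite -sum1_card; apply: eq_bigl => v; rewrite inE.
have one : \sum_(v in inner e W) \sum_(u in inner e W) (u == f v) = q.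
  rewrite /q -row big_mkcondr; apply: eq_bigr => v vi; case: ifP => fvi.
    by rewrite (bigD1 (f v)) //= eqxx big1 // => u /andP [_ /negPf ->].
  by rewrite big1 // => u ui; case: eqP => // E; rewrite -E ui in fvi.
under eq_bigr do rewrite big_split.
by rewrite big_split /= [X in _ + X]exchange_big /= one addnn.
Qed.

(** Taking S to be all components, or all but one with the shortest odd cycle, makes
the total odd and bounds it by the invariant n0 of the union of the components
meeting W. *)
Lemma critical_size_phi0 W b0 : W != set0 -> expanding e b0 W -> critical_size e (phi0 e) W.
Proof.
move=> W0 hb0; pose P := component_of e @: W.
have Pc C : C \in P -> C \in components e setT.
  by case/imsetP=> x _ ->; apply/componentsP; exists x.
have Pn C : C \in P -> ~~ bipartite e C.
  move=> CP; case/imsetP: (CP) => x xW Cx.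
  by apply: (expanding_meets_nonbipartite hb0 (Pc C CP) xW); rewrite Cx component_of_refl.
have sP : P \subset components e setT by apply/subsetP.
have phiP : n0 e (cover P) <= phi0 e.
  by apply: (@leq_bigmax_cond _ _ (fun P => n0 e (cover P))); rewrite inE.
have PE : nonbip_components e (cover P) = P.
  by rewrite nonbip_components_cover //; apply/setP=> C; rewrite inE;
    case: (boolP (C \in P)) => // /Pn ->.
pose k C := half_odd_girth e C; pose a C := #|C| - #|leaf_edges e C|.
have cycP C : C \in P -> 0 < k C /\ exists2 c, is_cycle e C c & odd (size c).
  move=> CP; have [f [z [_ _ kE cyc]]] :=
    nonbipartite_functional e_sym e_irr (Pc C CP) (Pn C CP) (e_pf (Pc C CP)).
  by split=> //; rewrite /k; case: (half_odd_girth e C) kE.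
have [x xW] := set0Pn _ W0; have CxP : component_of e x \in P by apply: imset_f.
have sumak : \sum_(C in P) a C <= \sum_(C in P) (a C - k C) + \sum_(C in P) k C.
  by rewrite -big_split; apply: leq_sum => C _ /=; lia.
have sumk S : S \subset P -> \sum_(C in S) (k C).*2.-1 + #|S| = (\sum_(C in S) k C).*2.
  move=> SP; rewrite -sum1_card -big_split -muln2 big_distrl /=; apply: eq_bigr => C CS.
  by have [k0 _] := cycP C (subsetP SP _ CS); rewrite muln2; lia.
have fin S m : S \subset P -> odd #|S| -> m <= phi0 e ->
    (\sum_(C in P) a C).*2 + 1 + #|S| <= m.*2 + (\sum_(C in S) k C).*2 -> critical_size e (phi0
      e) W.
  move=> SP oS mphi bound; have [b [q [hb qle E]]] := half_integral_weight hb0 SP.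
  have Sk := sumk S SP.
  move: E; rewrite -/(k _) => E.
  apply: (critical_size_le e_sym e_irr mphi).
  have ob : odd (\sum_(v in W) b v).
    have := odd_double q; rewrite -E oddD.
    have -> : odd (\sum_(C in S) (half_odd_girth e C).*2.-1) = true.
      by rewrite -oS; apply: odd_sum_odd => C CS; have [+ _] := cycP C (subsetP SP _ CS);
        rewrite /k; case: half_odd_girth => // n _; rewrite doubleS /= odd_double.
    by case: odd.
  have := odd_double_half (\sum_(v in W) b v); rewrite ob => bh.
  apply: (critical_size_le e_sym e_irr (n := (\sum_(v in W) b v)./2.+1)); last first.
    by right; exists b => //; lia.
  have {}qle : q <= \sum_(C in P) a C := qle.
  have {}E : \sum_(v in W) b v + \sum_(C in S) (k C).*2.-1 = q.*2 := E.
  move: E qle bound Sk bh.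
  move: (\sum_(v in W) b v) (\sum_(C in S) _) (\sum_(C in P) _) (\sum_(C in S) k C) => B K Aa Ks.
  by move=> *; lia.
have n0E : n0 e (cover P) = let s := #|P| in if odd s then \sum_(C in P) (a C - k C) + s./2 + 1
    else \sum_(C in P) (a C - k C) + s./2 + half_odd_girth e (cover P).
  by rewrite /n0 PE /= cards_eq0 ifN //; apply/set0Pn; exists (component_of e x).
move: n0E phiP => /= ->; case: ifP => oP phiP.
  apply: fin phiP _ => //; have := odd_double_half #|P|; rewrite oP.
  move: sumak; move: (\sum_(C in P) a C) (\sum_(C in P) (a C - k C)) (\sum_(C in P) k C) => Aa
    sg Ks.
  by move: (#|P|) (#|P|./2) => p h; lia.
have [C0 C0P k0] : exists2 C0, C0 \in P & k C0 <= half_odd_girth e (cover P).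
  have [_ [c cC oc]] := cycP _ CxP.
  have cW := is_cycleW (component_sub_cover CxP) cC.
  have [c' [cW' oc' gE]] := odd_girth_attained cW oc.
  have [y yc'] : exists y, y \in c' by case: (c') oc' => // y s _; exists y; rewrite mem_head.
  have yP : y \in cover P by have /and3P [_ _ /allP/(_ y yc')] := cW'.
  case/bigcupP: yP => C CP yC; exists C => //; rewrite /k /half_odd_girth gE.
  apply: half_leq; rewrite ltnS; apply: odd_girth_le oc'.
  by rewrite (component_eq e_sym (Pc C CP) yC); apply: is_cycle_comp cW' yc'.
have cardP : #|P| = #|P :\ C0|.+1 by rewrite (cardsD1 C0 P) C0P.
apply: (fin (P :\ C0) (\sum_(C in P) (a C - k C) + #|P|./2 + k C0)); first exact: subsetDl.
- by move: oP; rewrite cardP /= => /negbFE.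
- by apply: leq_trans phiP; rewrite leq_add2l.
have : \sum_(C in P) k C = k C0 + \sum_(C in P :\ C0) k C by rewrite (big_setD1 C0).
have := odd_double_half #|P|; rewrite oP cardP.
move: sumak; move: (\sum_(C in P) a C) (\sum_(C in P) (a C - k C)) (\sum_(C in P) k C) => Aa sg
  Ks.
by move: (\sum_(C in _) k C) (k C0) (#|P :\ C0|.+1./2) (#|P :\ C0|) => *; lia.
Qed.

End UpperBound.

(** * The stability index *)

Section Realization.
Variables (T : finType) (e : rel T).
Hypotheses (e_sym : ssrbool.symmetric e) (e_irr : irreflexive e) (e_pf : pseudoforest e).
Implicit Types (x y u v : T) (C W X : {set T}) (P Q : {set {set T}}).

Lemma phi0_gt0 : 0 < phi0 e.
Proof.
apply: leq_trans (@leq_bigmax_cond _ _ (fun P => n0 e (cover P)) set0 _); last first.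
  by rewrite inE sub0set.
have -> : n0 e (cover set0) = 1; last by [].
have cov0 : cover (set0 : {set {set T}}) = set0 by rewrite /cover big_set0.
rewrite /n0 cov0; have -> // : #|nonbip_components e set0| == 0.
rewrite cards_eq0; apply/eqP/setP=> C; rewrite !inE; apply/negbTE; rewrite negb_and; apply/orP;
  left.
by rewrite components_closed => [|x y]; [rewrite imset0 inE | rewrite inE].
Qed.

(** The vertex degrees form such a weight: if a set X did not expand, all edges at its
neighbours would lead back to X, and both sets together would form bipartite
components. *)
Lemma expanding_nonbipartite_components Q : Q \subset components e setT ->
  (forall C, C \in Q -> ~~ bipartite e C) -> exists b, expanding e b (cover Q).
Proof.
move=> sQ Qn; set W := cover Q; have clW : closed_set e W by apply: cover_closed.
pose b v := \sum_(u in W) e v u.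
have fm : fractional_matching e W b (fun v u => (e v u).*2).
  split=> [v u|v u|v vW]; first by rewrite e_sym.
    by case: (e v u).
  by rewrite -muln2 big_distrl; apply: eq_bigr => u _; rewrite /= muln2.
exists b => X XW X0 stX; pose N := nbrs e W X.
have NW : N \subset W by apply/subsetP=> y /nbrsP [].
have cut := cut_identity fm NW XW (subxx _).
suff [v [u [vN uX vu]]] : exists v u, [/\ v \in N, u \in W :\: X & e v u].
  have : (e v u).*2 <= \sum_(v in N) \sum_(u in W :\: X) (e v u).*2.
    by rewrite (bigD1 v) //= (bigD1 u) //= -addnA leq_addr.
  by rewrite vu; move: cut; rewrite -/N; lia.
have [/existsP [v /existsP [u /and3P [? ? ?]]]|no] :=
  boolP [exists v, [exists u, [&& v \in N, u \in W :\: X & e v u]]]; first by exists v, u.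
have {}no v u : v \in N -> e v u -> u \in X.
  move=> vN vu; apply/negPn/negP=> uX; case/negP: no; apply/existsP; exists v; apply/existsP;
    exists u.
  by rewrite vN vu inE uX (clW v u (subsetP NW _ vN) vu).
have nbX x y : x \in X -> e x y -> y \in N.
  by move=> xX xy; apply/nbrsP; split; [apply: clW (subsetP XW _ xX) xy | exists x].
have [x xX] := set0Pn _ X0; have /bigcupP [C CQ xC] := subsetP XW x xX.
have clS : closed_set e (X :|: N).
  move=> u v; rewrite !in_setU => /orP [uX|uN] uv; first by rewrite (nbX u) // orbT.
  by rewrite (no u).
have CS : C \subset X :|: N.
  rewrite (component_eq e_sym (subsetP sQ _ CQ) xC); apply: component_of_sub => //.
  by rewrite in_setU xX.
case/negP: (Qn C CQ); apply/existsP; exists X.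
apply/forallP=> u; apply/implyP=> uC; apply/forallP=> v; apply/implyP=> vC; apply/implyP=> uv.
case: (boolP (u \in X)) => uX; case: (boolP (v \in X)) => vX //.
  by have := stX _ _ uX vX; rewrite uv.
have := subsetP CS u uC; rewrite in_setU (negPf uX) /= => uN.
by rewrite (no u v uN uv) in vX.
Qed.

(** A maximal independent set of the complement of W dominates that complement and has
no neighbours in W. *)
Lemma remainder_realized W : closed_set e W -> exists X, stable e X /\ remainder e X = W.
Proof.
move=> clW.
pose ok (X : {set T}) := (X \subset ~: W) && [forall x in X, forall y in X, ~~ e x y].
have okP X : ok X -> stable e X.
  by case/andP=> _ /forallP h x y xX yX; have /implyP/(_ xX)/forallP/(_ y)/implyP/(_ yX) := h x.
have [X maxX] : {X | maxset ok X}.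
  apply: ex_maxset; exists set0; rewrite /ok sub0set /=; apply/forallP=> x; by rewrite inE.
have okX := maxsetp maxX; have stX := okP X okX; have /andP [XW _] := okX.
exists X; split=> //; apply/setP=> v; rewrite in_remainder.
have [vW|vW] := boolP (v \in W).
  have -> /= : v \notin X by apply/negP=> /(subsetP XW); rewrite inE vW.
  apply/nbrsP=> -[_ [x xX xv]]; have := subsetP XW x xX; rewrite inE.
  by rewrite (clW v x vW) // e_sym.
apply/negbTE; rewrite negb_and !negbK; have [//|vX] := boolP (v \in X) => /=.
apply/negPn/negP=> vN.
have nov x : x \in X -> ~~ e x v.
  by move=> xX; apply: contra vN => xv; apply/nbrsP; split; rewrite ?inE //; exists x.
have okv : ok (v |: X).
  rewrite /ok subUset sub1set inE vW XW /=.
  apply/forallP=> x; apply/implyP=> /setU1P hx; apply/forallP=> y; apply/implyP=> /setU1P hy.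
  case: hx hy => [->|xX] [->|yX]; first by rewrite e_irr.
  - by rewrite e_sym nov.
  - exact: nov.
  - exact: stX.
by move: vX; rewrite -(maxsetsup maxX okv (subsetUr _ _)) setU11.
Qed.

(** The nonbipartite components of a subgraph reaching the maximum phi0 form a
remainder that becomes critical no earlier than phi0. *)
Lemma late_remainder m : 0 < m < phi0 e -> exists X n,
  [/\ stable e X, critical_size e n (remainder e X) & ~ critical_size e m (remainder e X)].
Proof.
case/andP=> m0 mphi.
have [|P PS phiE] := @eq_bigmax_cond _ (mem (powerset (components e setT))) (fun P => n0 e
  (cover P)).
  by apply/card_gt0P; exists set0; have := sub0set (components e setT); rewrite -powersetE.
have sP : P \subset components e setT by move: PS; rewrite /= inE.
have {}phiE : phi0 e = n0 e (cover P) by [].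
pose Q := [set C in P | ~~ bipartite e C].
have Qn C : C \in Q -> ~~ bipartite e C by rewrite inE => /andP [].
have sQ : Q \subset components e setT.
  by apply: subset_trans sP; apply/subsetP=> C; rewrite inE => /andP [].
have Q0 : Q != set0.
  apply/eqP=> Q0; move: mphi; rewrite phiE /n0 nonbip_components_cover // -/Q Q0 cards0 /=.
  by case: m m0 => [|[]].
have [X [stX XE]] := remainder_realized (cover_closed sQ).
have [b hb] := expanding_nonbipartite_components sQ Qn.
have W0 : cover Q != set0.
  have [C CQ] := set0Pn _ Q0; have /componentsP [x Cx] := subsetP sQ C CQ.
  by apply/set0Pn; exists x; apply/bigcupP; exists C => //; rewrite Cx component_of_refl.
exists X, (phi0 e); rewrite XE; split=> //; first exact: critical_size_phi0 hb.
by move/(n0_lower_bound e_sym e_irr e_pf sP) => /(_ Q0); rewrite -phiE leqNgt mphi.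
Qed.

End Realization.

Theorem theorem5p8 (K : fieldType) (r : nat) (e : rel 'I_r)
  (e_sym : ssrbool.symmetric e) (e_irr : irreflexive e) (e_pf : pseudoforest e) :
  is_astab_closure (edge_ideal K e) (phi0 e).
Proof.
have phi_gt0 : 0 < phi0 e by apply: phi0_gt0.
split=> // [n phin P|n n0 stab].
  have n0 := leq_trans phi_gt0 phin.
  rewrite !Ass_closureP //; split=> -[X [stX cX PX]]; exists X; split=> //.
    have [W0|W0] := eqVneq (remainder e X) set0; first by left.
    case: cX => [E|[b hb _]]; first by rewrite E eqxx in W0.
    exact: critical_size_phi0 W0 hb.
  exact: (critical_size_le e_sym e_irr phin).
rewrite leqNgt; apply/negP=> lt.
have [|X [N [stX cX ncX]]] := @late_remainder _ e e_sym e_irr e_pf n; first by rewrite n0.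
have nN : n <= maxn n N by apply: leq_maxl.
have AX : Ass (integral_closure (ideal_pow (edge_ideal K e) (maxn n N))) (@monomial_prime K r (~: X)).
  apply/Ass_closureP => //; first exact: leq_trans n0 nN.
  exists X; split=> //; apply: (critical_size_le e_sym e_irr) cX; exact: leq_maxr.
have /Ass_closureP [//|//|//|Y [_ cY PY]] := (stab _ nN _).1 AX.
apply: ncX; have -> // : X = Y.
apply: (inv_inj (@setCK _)); apply/setP=> i.
by apply/idP/idP=> /(@monomial_primeX K r) /PY/monomial_primeX.
Qed.
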